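(* Let $S$ be a subcartesian space. The family $\mathcal{X}(S)$ of all vector fields on $S$ is locally complete.
   Context: Differential spaces. A differential structure on a topological space $R$ is a family $C^{\infty}(R)$ of functions $R\to\mathbb{R}$ such that: (i) the sets $f^{-1}((a,b))$, $f\in C^{\infty}(R)$, $a,b\in\mathbb{R}$, form a sub-basis for the topology of $R$; (ii) if $f_1,\dots,f_n\in C^{\infty}(R)$ and $F\in C^{\infty}(\mathbb{R}^n)$ then $F(f_1,\dots,f_n)\in C^{\infty}(R)$; (iii) if $f:R\to\mathbb{R}$ is such that every $x\in R$ has an open neighbourhood $U_x$ and a function $f_x\in C^{\infty}(R)$ with $f|U_x=f_x|U_x$, then $f\in C^{\infty}(R)$. A differential space is a topological space with a differential structure. A continuous map $\varphi:S\to R$ is smooth if $f\circ\varphi\in C^{\infty}(S)$ for all $f\in C^{\infty}(R)$; a homeomorphism $\varphi$ is a diffeomorphism if $\varphi,\varphi^{-1}$ are smooth. A subset $S\subseteq R$ with the subspace topology is a differential subspace with $f\in C^{\infty}(S)$ iff each $x\in S$ has an open neighbourhood $U$ in $R$ and $f_x\in C^{\infty}(R)$ with $f|(S\cap U)=f_x|(S\cap U)$. A subcartesian space is a Hausdorff differential space covered by open sets each of which is diffeomorphic to a differential subspace of some $\mathbb{R}^n$. Standing assumption: all differential spaces are Hausdorff, second countable and paracompact. Vector fields. A derivation of $C^{\infty}(S)$ is a linear map $X:C^{\infty}(S)\to C^{\infty}(S)$, $f\mapsto X\cdot f$, satisfying Leibniz' rule. An integral curve of $X$ through $x$ is a smooth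 curve $c:I\to S$, $I\subseteq\mathbb{R}$ an interval (possibly a single point) containing $0$, with $c(0)=x$ and $\frac{d}{dt}f(c(t))=(X\cdot f)(c(t))$ for all $f\in C^{\infty}(S)$, $t\in I$. On a subcartesian space every derivation has a unique maximal integral curve through each $x$; $\varphi^X_t(x)$ denotes its value at $t$, when defined. A derivation $X$ is a vector field if for every $x\in S$ there are an open neighbourhood $U$ of $x$ and $\varepsilon>0$ such that for all $t\in(-\varepsilon,\varepsilon)$ the map $\varphi^X_t$ is defined on $U$ and restricts to a diffeomorphism of $U$ onto an open subset of $S$. Local completeness. For a diffeomorphism $\varphi:U\to V$ of open subsets of $S$, the push-forward $\varphi_*Y$ is the derivation of $C^{\infty}(V)$ with $(\varphi_*Y)\cdot f=(Y\cdot(f\circ\varphi))\circ\varphi^{-1}$. A family $\mathcal{F}$ of vector fields is locally complete if for all $X,Y\in\mathcal{F}$, $t\in\mathbb{R}$ and $x\in S$ for which $\varphi^X_{t*}Y(x)$ is defined, there exist an open neighbourhood $U$ of $x$ and $Z\in\mathcal{F}$ with $\varphi^X_{t*}Y|U=Z|U$. *)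

(* Defs.v *)
From HB Require Import structures.
From mathcomp Require Import all_boot all_order all_algebra.
From mathcomp Require Import all_classical all_reals all_analysis.
Import numFieldNormedType.Exports.

Set Implicit Arguments.
Unset Strict Implicit.
Unset Printing Implicit Defensive.

Import Order.TTheory GRing.Theory Num.Theory.
Local Open Scope classical_set_scope.
Local Open Scope ring_scope.

(* Subsets are not turned into types: an object living on a subset A of a space
   (a function on A, a map defined on A, a curve on an interval) is represented
   by a total function, whose values outside A are irrelevant and are never
   constrained.  Likewise a derivation of a family C of functions is a total
   operator on all functions, constrained on C only. *)

Definition partials (R : realType) (n : nat) (s : seq 'I_n)
    (F : 'rV[R]_n -> R) : 'rV[R]_n -> R :=
  foldr (fun i (G : 'rV[R]_n -> R) => 'D_(delta_mx 0 i) G) F s.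

Definition smooth_rV (R : realType) (n : nat) : set ('rV[R]_n -> R) :=
  [set F | forall s : seq 'I_n, continuous (partials s F) /\
     forall (i : 'I_n) (x : 'rV[R]_n), derivable (partials s F) x (delta_mx 0 i)].

Definition smooth_line (R : realType) : set (R -> R) :=
  [set g | forall (k : nat) (x : R), derivable (derive1n k g) x 1].

Section DifferentialSpaces.
Context {R : realType}.

(* C^oo(A) for the differential subspace A of (T, C). *)
Definition subspace_structure (T : topologicalType) (C : set (T -> R))
    (A : set T) : set (T -> R) :=
  [set f | forall x, A x -> exists (U : set T) (g : T -> R),
     [/\ open_nbhs x U, C g & forall y, A y -> U y -> f y = g y]].

Record differential_structure (T : topologicalType) (C : set (T -> R)) : Prop := {
  ds_subbasis : basis (finI_from
    [set A : set T | exists (f : T -> R) (a b : R),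
       C f /\ A = f @^-1` [set y | a < y < b]] id) ;
  ds_comp : forall (n : nat) (f : 'I_n -> T -> R) (F : 'rV[R]_n -> R),
    (forall i, C (f i)) -> smooth_rV F -> C (fun x => F (\row_i f i x)) ;
  ds_local : forall f : T -> R,
    (forall x, exists (U : set T) (g : T -> R),
       [/\ open_nbhs x U, C g & forall y, U y -> f y = g y]) -> C f }.

(* Smooth map from the differential subspace A of (S, C) to the differential
   subspace B of (T, D). *)
Definition smooth_map (S T : topologicalType) (C : set (S -> R)) (A : set S)
    (D : set (T -> R)) (B : set T) (phi : S -> T) : Prop :=
  [/\ forall x, A x -> B (phi x),
      {within A, continuous phi} &
      forall f, subspace_structure D B f -> subspace_structure C A (f \o phi)].

(* phi is a diffeomorphism of A onto B with inverse psi. *)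
Definition diffeomorphism (S T : topologicalType) (C : set (S -> R)) (A : set S)
    (D : set (T -> R)) (B : set T) (phi : S -> T) (psi : T -> S) : Prop :=
  [/\ smooth_map C A D B phi, smooth_map D B C A psi,
      forall x, A x -> psi (phi x) = x & forall y, B y -> phi (psi y) = y].

Definition paracompact (T : topologicalType) : Prop :=
  forall P : set (set T), P `<=` open -> \bigcup_(A in P) A = setT ->
  exists Q : set (set T), [/\ Q `<=` open, \bigcup_(B in Q) B = setT,
    forall B, Q B -> exists2 A, P A & B `<=` A &
    forall x, exists2 W, open_nbhs x W &
      finite_set [set B | Q B /\ B `&` W !=set0]].

Record subcartesian (S : topologicalType) (C : set (S -> R)) : Prop := {
  sc_structure : differential_structure C ;
  sc_hausdorff : hausdorff_space S ;
  sc_second_countable : @second_countable S ;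
  sc_paracompact : paracompact S ;
  sc_charts : forall x : S, exists (U : set S) (n : nat) (A : set 'rV[R]_n)
      (phi : S -> 'rV[R]_n) (psi : 'rV[R]_n -> S),
    open_nbhs x U /\ diffeomorphism C U (@smooth_rV R n) A phi psi }.

Section VectorFields.
Context {S : topologicalType} (C : set (S -> R)).

Implicit Types (X : (S -> R) -> (S -> R)) (U V : set S).

Record derivation X : Prop := {
  derivation_closed : forall f, C f -> C (X f) ;
  derivation_add : forall f g, C f -> C g -> X (f \+ g) = X f \+ X g ;
  derivation_scale : forall (a : R) f, C f ->
    X (fun x => a * f x) = (fun x => a * X f x) ;
  derivation_leibniz : forall f g, C f -> C g ->
    X (f \* g) = (f \* X g) \+ (g \* X f) }.

(* At an endpoint of I the derivative is one-sided; for I = [set 0] the filter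
   [within I 0^'] is trivial and the differential equation is vacuous. *)
Record integral_curve X (x : S) (I : set R) (c : R -> S) : Prop := {
  ic_interval : is_interval I ;
  ic_zero : I 0 ;
  ic_start : c 0 = x ;
  ic_smooth : smooth_map (@smooth_line R) I C setT c ;
  ic_deriv : forall (f : S -> R) (t : R), C f -> I t ->
    (s - t)^-1 * (f (c s) - f (c t)) @[s --> within I t^'] --> X f (c t) }.

Definition maximal_integral_curve X (x : S) (I : set R) (c : R -> S) : Prop :=
  integral_curve X x I c /\
  forall (J : set R) (d : R -> S), integral_curve X x J d -> I `<=` J ->
    (forall t, I t -> d t = c t) -> J = I.

(* phi^X_t (x) is defined and equal to y. *)
Definition flow X (t : R) (x y : S) : Prop :=
  exists (I : set R) (c : R -> S),
    [/\ maximal_integral_curve X x I c, I t & c t = y].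

(* phi^X_t is defined on the open set U and restricts there to a diffeomorphism
   phi, with inverse psi, onto the open set V. *)
Definition flow_diffeomorphism X (t : R) U V (phi psi : S -> S) : Prop :=
  [/\ open U, open V, diffeomorphism C U C V phi psi &
      forall x, U x -> flow X t x (phi x)].

Definition vector_field X : Prop :=
  derivation X /\
  forall x : S, exists (U : set S) (e : R), [/\ open_nbhs x U, 0 < e &
    forall t : R, - e < t < e ->
      exists V phi psi, flow_diffeomorphism X t U V phi psi].

End VectorFields.

(* The restriction of a derivation X of D to an open set U, evaluated on
   f \in C^oo(U): its value at x \in U is (X . g) x for any g \in D that agrees
   with f near x; such a g exists by definition of C^oo(U) and, derivations being
   local, its choice does not matter. *)
Definition restriction (S : topologicalType) (D : set (S -> R))
    (X : (S -> R) -> (S -> R)) (f : S -> R) : S -> R :=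
  fun x => X (xget (cst 0) [set g | D g /\ \forall y \near x, g y = f y]) x.

(* phi_* Y, acting on C^oo(V), for a diffeomorphism phi : U -> V with inverse psi
   between open subsets; Y acts on f \o phi \in C^oo(U) by restriction. *)
Definition pushforward (S : topologicalType) (C : set (S -> R))
    (phi psi : S -> S) (Y : (S -> R) -> (S -> R)) (f : S -> R) : S -> R :=
  restriction C Y (f \o phi) \o psi.

(* phi^X_{t*} Y is defined at x when phi^X_t restricts to a diffeomorphism phi of
   an open set U onto an open set V containing x.  The restrictions to W are
   compared as derivations of C^oo(W). *)
Definition locally_complete (S : topologicalType) (C : set (S -> R))
    (F : set ((S -> R) -> (S -> R))) : Prop :=
  forall X Y, F X -> F Y -> forall (t : R) (x : S) (U V : set S) (phi psi : S -> S),
    flow_diffeomorphism C X t U V phi psi -> V x ->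
    exists (W : set S) (Z : (S -> R) -> (S -> R)),
      [/\ open_nbhs x W, W `<=` V, F Z &
        forall f, subspace_structure C W f -> forall y, W y ->
          restriction (subspace_structure C V) (pushforward C phi psi Y) f y =
          restriction C Z f y].

End DifferentialSpaces.

(* Main.v *)
Require Import Defs.
From HB Require Import structures.
From mathcomp Require Import all_boot all_order all_algebra.
From mathcomp Require Import all_classical all_reals all_analysis.
From mathcomp Require Import ring lra.
Import numFieldNormedType.Exports.
Set Implicit Arguments.
Unset Strict Implicit.
Unset Printing Implicit Defensive.
Import Order.TTheory GRing.Theory Num.Theory.
Local Open Scope classical_set_scope.
Local Open Scope ring_scope.

(** The push-forward of Y lives on V only, so it is multiplied by a bump h
    supported in V and extended by 0; call the result Z.  On the set where h is 1
    it is the push-forward, and it is a derivation because derivations are local.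
    The content of the theorem is that Z is a vector field: a derivation need not
    have integral curves that move points by local diffeomorphisms.

    Integral curves of Z come from those of Y.  If c is an integral curve of Y
    and u solves the scalar equation u' = h (phi (c u)), then phi o c o u is an
    integral curve of Z ([reparametrized_curves], [scalar_ode]).  Curves that
    start near a point stay near it for a uniform time ([confinement]), so that
    all the curves of Z starting near a point are defined on a common interval.

    It remains to see that such a family of curves moves points by
    diffeomorphisms of open sets ([vector_field_criterion]).  Near each point S
    is a subset of some R^n, with no regularity at all, and smoothness on S means
    being locally the restriction of a smooth function on R^n.  Therefore the
    flow has to be the restriction of a smooth map of R^n.  The derivation
    extends to a compactly supported vector field G on R^n ([field_extension]),
    and the map is the limit of the Euler approximations of G.  That limit
    agrees with every curve satisfying the differential equation
    ([flow_limit_solution]), so that the flow on S is its restriction; this also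
    gives the uniqueness from which the time t and time - t maps are inverse to
    each other.  The limit is smooth ([flow_limit_smooth]): the derivative of an
    Euler approximation is the Euler approximation for the tangent field
    (y, v) |-> (G y, DG y v), which is a field of the same kind once the
    velocities are truncated, so all partial derivatives are again limits of
    Euler approximations, uniformly.  Existence of solutions in R^n is never at
    stake, since the curves are given.

    Smoothness is proved throughout by coinduction: a family of functions that
    is closed under differentiation consists of smooth functions. *)

(** * Derivatives on the line *)

Section LineCalculus.
Context {R : realType}.
Implicit Types (f g u v : R -> R) (x y t : R).

Lemma is_derive_epsP f x d :
  is_derive x (1 : R) f d <->
  forall e, 0 < e -> exists2 r, 0 < r &
    forall y, `|y - x| < r -> `|f y - f x - d * (y - x)| <= e * `|y - x|.
Proof.
have conv : (h^-1 *: (f (h *: (1 : R) + x) - f x) @[h --> 0^'] --> d) <->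
  forall e, 0 < e -> exists2 r, 0 < r &
    forall y, `|y - x| < r -> `|f y - f x - d * (y - x)| <= e * `|y - x|.
  split.
    move/cvgrPdist_le => H e /H; rewrite near_withinE => -[r /= r0 Hr].
    exists r => // y yx.
    have [->|yNx] := eqVneq y x; first by rewrite !subrr mulr0 subr0 normr0 mulr0.
    have yx0 : y - x != 0 by rewrite subr_eq0.
    have /= := Hr (y - x).
    rewrite sub0r normrN => /(_ yx yx0).
    rewrite /GRing.scale /= mulr1 subrK.
    rewrite -[X in X <= _ -> _](@mulfK _ (`|y - x|)) ?normr_eq0 //.
    rewrite ler_pdivrMr ?normr_gt0 // -normrM mulrBl mulrC.
    have -> : (y - x)^-1 * (f y - f x) * (y - x) = f y - f x.
      by rewrite mulrAC mulVf // mul1r.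
    by rewrite distrC [(y - x) * d]mulrC.
  move=> H; apply/cvgrPdist_le => e /H [r r0 Hr]; rewrite near_withinE.
  exists r => //= h /=; rewrite sub0r normrN => hr h0.
  have := Hr (h + x); rewrite addrK => /(_ hr).
  rewrite /GRing.scale /= mulr1.
  have -> : d - h^-1 * (f (h + x) - f x) = - (f (h + x) - f x - d * h) / h.
    by field.
  by rewrite normrM normrN normfV ler_pdivrMr ?normr_gt0.
split=> [[df dE]|/(proj2 conv) H].
  by apply: (proj1 conv); rewrite -dE; exact: df.
apply: DeriveDef; first by apply/cvg_ex; exists d.
exact/cvg_lim.
Qed.

Lemma is_derive_continuous f x d : is_derive x (1 : R) f d -> {for x, continuous f}.
Proof.
by move=> [df _]; apply/differentiable_continuous/derivable1_diffP.
Qed.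

Lemma is_derive_chain f g x df dg :
  is_derive x (1 : R) f df -> is_derive (f x) (1 : R) g dg ->
  is_derive x (1 : R) (g \o f) (dg * df).
Proof.
move=> [Df <-] [Dg <-].
have := derive1_comp Df Dg; rewrite !derive1E => <-.
apply: derivableP; apply/derivable1_diffP.
by apply: differentiable_comp; exact/derivable1_diffP.
Qed.

Lemma eq_is_derive f g x d :
  f =1 g -> is_derive x (1 : R) f d -> is_derive x (1 : R) g d.
Proof. by move=> /funext ->. Qed.

Lemma is_derive_affine (c b t : R) : is_derive t (1 : R) (fun h : R => h * c + b) c.
Proof.
apply/is_derive_epsP => e e0; exists 1 => // y _.
have -> : y * c + b - (t * c + b) - c * (y - t) = 0 by ring.
by rewrite normr0 mulr_ge0 // ltW.
Qed.

Lemma mvt_seg f df (a b : R) :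
  (forall x, Num.min a b <= x <= Num.max a b -> is_derive x (1 : R) f (df x)) ->
  exists2 c, Num.min a b <= c <= Num.max a b & f b - f a = df c * (b - a).
Proof.
wlog ab : a b / a <= b.
  move=> W H; have /orP[ab|ba] := le_total a b; first exact: (W a b ab H).
  have [|c cab E] := W b a ba; first by move=> x xab; apply: H; rewrite minC maxC.
  exists c; first by rewrite minC maxC.
  by rewrite -opprB E -mulrN opprB.
rewrite (min_idPl ab) (max_idPr ab) => H.
have [||c cab E] := @MVT_segment R f df a b ab.
- by move=> x; rewrite in_itv /= => /andP[/ltW ? /ltW ?]; apply: H; lra.
- apply: derivable_within_continuous => x; rewrite in_itv /= => /H [] //.
by exists c => //; move: cab; rewrite in_itv.
Qed.

Lemma mvt_bound f df (a b M : R) :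
  (forall x, Num.min a b <= x <= Num.max a b ->
     is_derive x (1 : R) f (df x) /\ `|df x| <= M) ->
  `|f b - f a| <= M * `|b - a|.
Proof.
move=> H; have [|c /H [_ Mc] ->] := @mvt_seg f df a b.
  by move=> x /H [].
by rewrite normrM ler_wpM2r.
Qed.

(** The mean value inequality for u_m - u_k, with m going to infinity, bounds the
    increments of u - u_k by a small multiple of |y - x|.  Up to that error, u has
    the increments of u_k. *)
Lemma is_derive_unif_lim (u_ v_ : nat -> R -> R) u v (a : R) :
  (forall k x, `|x| < a -> is_derive x (1 : R) (u_ k) (v_ k x)) ->
  (forall e, 0 < e -> exists K, forall k, (K <= k)%N -> forall x, `|x| < a ->
     `|u_ k x - u x| <= e /\ `|v_ k x - v x| <= e) ->
  forall x, `|x| < a -> is_derive x (1 : R) u (v x).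
Proof.
move=> D U x xa; apply/is_derive_epsP => e e0.
have e4 : 0 < e / 4 by lra.
have [K HK] := U _ e4.
have /is_derive_epsP /(_ _ e4) [r r0 Hr] := D K x xa.
exists (Num.min r (a - `|x|)); first by rewrite lt_min r0 subr_gt0.
move=> y; rewrite lt_min => /andP[yr ya].
have xya z : Num.min x y <= z <= Num.max x y -> `|z| < a.
  move=> z_; have : `|z - x| <= `|y - x|.
    by case: (leP x y) z_ => xy /andP[z1 z2]; case: (ger0P (z - x)) => ?; case: (ger0P (y - x)) => ?; lra.
  have := ler_normB z (z - x); have -> : z - (z - x) = x by lra.
  have := ler_normD (z - x) x; rewrite subrK; lra.
have key m : (K <= m)%N ->
    `|(u_ m y - u_ K y) - (u_ m x - u_ K x)| <= e / 2 * `|y - x|.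
  move=> Km; apply: (@mvt_bound (u_ m \- u_ K) (v_ m \- v_ K)) => z /xya za.
  split; first by apply: is_deriveB; exact: D.
  have [_ h1] := HK m Km z za; have [_ h2] := HK K (leqnn K) z za.
  have := ler_distD (v z) (v_ m z) (v_ K z).
  by rewrite [`|v z - _|]distrC /=; lra.
have ylt : `|y| < a by apply: xya; case: (leP x y); lra.
have lim : `|(u y - u_ K y) - (u x - u_ K x)| <= e / 2 * `|y - x|.
  apply/ler_addgt0Pl => d d0.
  have [K' HK'] := U (d / 2) ltac:(lra).
  have [h1 _] := HK' (maxn K K') (leq_maxr _ _) y ylt.
  have [h2 _] := HK' (maxn K K') (leq_maxr _ _) x xa.
  have h := key (maxn K K') (leq_maxl _ _).
  move: h1 h2 h; set m := maxn _ _.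
  rewrite !ler_norml; lra.
have := Hr y yr.
have -> : u y - u x - v x * (y - x) = ((u y - u_ K y) - (u x - u_ K x)) +
  ((u_ K y - u_ K x - v_ K x * (y - x)) + (v_ K x - v x) * (y - x)) by ring.
move=> h; apply: le_trans (ler_normD _ _) _.
apply: le_trans (lerD (lexx _) (ler_normD _ _)) _.
have [_ h3] := HK K (leqnn K) x xa.
have : `|(v_ K x - v x) * (y - x)| <= e / 4 * `|y - x|.
  by rewrite normrM ler_wpM2r.
lra.
Qed.

End LineCalculus.

(** * Smooth functions of one variable and bumps *)

Section SmoothLine.
Context {R : realType}.
Implicit Types (f g : R -> R) (x y t : R).

(** Coinduction.  In the applications P is the closure of the functions at hand
    under the operations that occur in the rules of differentiation. *)
Lemma smooth_line_coind (P : set (R -> R)) :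
  (forall g, P g -> exists2 g', P g' & forall x, is_derive x (1 : R) g (g' x)) ->
  P `<=` @smooth_line R.
Proof.
move=> HP g Pg k x; have : P (derive1n k g).
  elim: k => [//|k IH]; rewrite derive1nS.
  have [g' Pg' D] := HP _ IH.
  suff -> : (derive1n k g)^`()%classic = g' by [].
  by apply/funext => y; rewrite derive1E; have [_ ->] := D y.
by move=> /HP [g' _ /(_ x) []].
Qed.

Lemma smooth_line_derive g : smooth_line g -> smooth_line (g^`()%classic).
Proof. by move=> sg k x; rewrite -derive1Sn; exact: sg. Qed.

Lemma smooth_line_is_derive g x :
  smooth_line g -> is_derive x (1 : R) g (g^`()%classic x).
Proof. by move=> /(_ 0%N x) sg; rewrite derive1E; exact: derivableP. Qed.

Inductive line_expr : (R -> R) -> Prop :=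
| lg_base g : smooth_line g -> line_expr g
| lg_cst c : line_expr (fun=> c)
| lg_id : line_expr id
| lg_add f g : line_expr f -> line_expr g -> line_expr (f \+ g)
| lg_mul f g : line_expr f -> line_expr g -> line_expr (f \* g)
| lg_comp f g : smooth_line f -> line_expr g -> line_expr (f \o g)
| lg_inv g : (forall x, g x != 0) -> line_expr g -> line_expr (fun x => (g x)^-1).

Lemma line_expr_smooth g : line_expr g -> smooth_line g.
Proof.
apply: (smooth_line_coind (P := line_expr)) => {}g.
elim=> {g} [g sg|c||f g lf [f' lf' Df] lg [g' lg' Dg]
  |f g lf [f' lf' Df] lg [g' lg' Dg]|f g sf lg [g' lg' Dg]|g g0 lg [g' lg' Dg]].
- exists (g^`()%classic) => [|x]; last exact: smooth_line_is_derive.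
  exact/lg_base/smooth_line_derive.
- by exists (fun=> 0); [exact: lg_cst|move=> x; exact: is_derive_cst].
- by exists (fun=> 1); [exact: lg_cst|move=> x; exact: is_derive_id].
- exists (f' \+ g'); first exact: lg_add.
  by move=> x; exact: is_deriveD.
- exists ((f \* g') \+ (g \* f')).
    by apply: lg_add; exact: lg_mul.
  by move=> x; have := is_deriveM (Df x) (Dg x).
- exists ((f^`()%classic \o g) \* g').
    by apply: lg_mul => //; apply: lg_comp => //; exact: smooth_line_derive.
  by move=> x; apply: is_derive_chain => //; exact: smooth_line_is_derive.
- exists ((fun=> -1) \* (((fun x => (g x)^-1) \* (fun x => (g x)^-1)) \* g')).
    apply: lg_mul; first exact: lg_cst.
    by apply: lg_mul => //; apply: lg_mul; exact: lg_inv.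
  move=> x; apply: (is_derive_eq (@is_deriveV _ g x _ 1 (g0 x) (Dg x))); rewrite /GRing.scale /= -exprVn; ring.
Qed.

(** The derivatives of the classical function exp (- 1 / x), extended by 0 to the
    negative half-line, are linear combinations of these. *)
Definition flat (m : nat) x := if 0 < x then x^-1 ^+ m * expR (- x^-1) else 0.

(** The term of order m + 2 of the exponential series at 1 / x bounds exp (1 / x)
    from below.  The second order vanishing at 0 makes [flat m] differentiable
    there, for every m. *)
Lemma flat_le m x : `|flat m x| <= (m.+2)`!%:R * x ^+ 2.
Proof.
rewrite /flat; case: ltP => [x0|_]; last by rewrite normr0 mulr_ge0 // sqr_ge0.
have xV0 : 0 < x^-1 by rewrite invr_gt0.
rewrite ger0_norm; last by rewrite mulr_ge0 ?expR_ge0 // exprn_ge0 // ltW.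
have := @expR_ge1Dxn _ x^-1 m.+1 (ltW xV0) => /(le_trans _) H.
have {H} : x^-1 ^+ m.+2 / (m.+2)`!%:R <= expR x^-1 by apply: H; rewrite lerDr.
have F0 : 0 < (m.+2)`!%:R :> R by rewrite ltr0n fact_gt0.
rewrite ler_pdivrMr // expRN ler_pdivrMr ?expR_gt0 //.
have E : x^-1 ^+ m = x^-1 ^+ m.+2 * x ^+ 2.
  by rewrite -addn2 exprD -mulrA -exprMn mulVf ?expr1n ?mulr1 // gt_eqF.
rewrite E => h; have x2 : 0 < x ^+ 2 by rewrite exprn_gt0.
by rewrite -[X in _ <= X]mulrAC ler_pM2r // mulrC.
Qed.

Lemma flat_derive m x :
  is_derive x (1 : R) (flat m) (- m%:R * flat m.+1 x + flat m.+2 x).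
Proof.
have [x0|x0|x0] := ltgtP x 0.
- apply: (@near_eq_is_derive _ _ _ (cst 0)); last first.
    by rewrite /flat ltNge ltW //= mulr0 addr0; exact: is_derive_cst.
  near=> y; rewrite /flat ltNge ltW //=; near: y; exact: lt_nbhsl.
- have H : is_derive x (1 : R) (fun y => y^-1 ^+ m * expR (- y^-1))
     (- m%:R * flat m.+1 x + flat m.+2 x).
    have xN0 : x != 0 by rewrite gt_eqF.
    have DV : is_derive x (1 : R) (fun y => y^-1) (- x^-1 ^+ 2).
      by apply: (is_derive_eq (@is_deriveV _ id x 1 1 xN0 (is_derive_id _ _))); rewrite /GRing.scale /= mulr1 exprVn.
    have DE : is_derive x (1 : R) (fun y => expR (- y^-1)) (expR (- x^-1) * x^-1 ^+ 2).
      apply: (@is_derive_chain _ (fun y => - y^-1) expR).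
      by apply: (is_derive_eq (is_deriveN DV)); rewrite opprK.
    have DX : is_derive x (1 : R) (fun y => y^-1 ^+ m) (- m%:R * x^-1 ^+ m.+1).
      have -> : (fun y : R => y^-1 ^+ m) = (fun y : R => y^-1) ^+ m.
        by apply/funext => y; rewrite exprfctE.
      apply: (is_derive_eq (@is_deriveX _ _ _ m x 1 _ DV)); case: m => [|m]; first by rewrite /GRing.scale /= ?mulr0n ?oppr0 !mul0r.
      rewrite /GRing.scale /= !exprS; ring.
    apply: (is_derive_eq (is_deriveM DX DE)).
    rewrite /flat x0 /GRing.scale /= !exprS; ring.
  apply: near_eq_is_derive H.
  near=> y; rewrite /flat ifT //; near: y; exact: lt_nbhsr.
- rewrite x0 /flat ltxx mulr0 addr0; apply/is_derive_epsP => e e0.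
  have F0 : 0 < (m.+2)`!%:R :> R by rewrite ltr0n fact_gt0.
  exists (e / (m.+2)`!%:R); first by rewrite divr_gt0.
  move=> y; rewrite subr0 ltr_pdivlMr // => ye.
  rewrite ltxx subr0 mul0r subr0; have := flat_le m y; rewrite /flat => /le_trans; apply.
  have -> : y ^+ 2 = `|y| * `|y| by rewrite -normrM ger0_norm ?expr2 // sqr_ge0.
  by rewrite mulrA ler_wpM2r // mulrC ltW.
Unshelve. all: by end_near. Qed.

Inductive flat_span : (R -> R) -> Prop :=
| fs_flat m : flat_span (flat m)
| fs_add f g : flat_span f -> flat_span g -> flat_span (f \+ g)
| fs_scale c f : flat_span f -> flat_span (fun x => c * f x).

Lemma flat_smooth m : smooth_line (flat m).
Proof.
apply: (smooth_line_coind (P := flat_span)); last exact: fs_flat.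
move=> g; elim=> {g m} [m|f g _ [f' ? ?] _ [g' ? ?]|c f _ [f' ? ?]].
- exists (fun x => - m%:R * flat m.+1 x + flat m.+2 x); last exact: flat_derive.
  apply: (fs_add (f := fun x => - m%:R * flat m.+1 x)); last exact: fs_flat.
  by apply: fs_scale; exact: fs_flat.
- by exists (f' \+ g'); [exact: fs_add|move=> x; exact: is_deriveD].
- by exists (fun x => c * f' x); [exact: fs_scale|move=> x; exact: is_deriveZ].
Qed.

(** 0 for x <= 0 and 1 for x >= 1; the denominator is positive since x or 1 - x
    is. *)
Definition smooth_step x := flat 0 x / (flat 0 x + flat 0 (1 - x)).

Lemma flat0_ge0 x : 0 <= flat 0 x.
Proof. by rewrite /flat; case: ifP => // _; rewrite mul1r expR_ge0. Qed.

Lemma flat0_gt0 x : 0 < x -> 0 < flat 0 x.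
Proof. by rewrite /flat => ->; rewrite mul1r expR_gt0. Qed.

Lemma flat0_eq0 x : x <= 0 -> flat 0 x = 0.
Proof. by rewrite /flat leNgt => /negbTE ->. Qed.

Lemma smooth_step_smooth : smooth_line smooth_step.
Proof.
apply: line_expr_smooth; have l0 : line_expr (flat 0) by apply/lg_base/flat_smooth.
apply: (lg_mul (f := flat 0)) => //; apply: lg_inv.
  move=> x; rewrite gt_eqF //; have [x0|x0] := ltP 0 x.
    by rewrite ltr_pwDl ?flat0_gt0 ?flat0_ge0.
  by rewrite ltr_wpDl ?flat0_gt0 ?flat0_ge0 //; lra.
apply: (lg_add (f := flat 0)) => //.
apply: (lg_comp (f := flat 0) (g := fun x => 1 - x)); first exact: flat_smooth.
apply: (lg_add (f := fun=> 1) (g := fun x => - x)); first exact: lg_cst.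
have -> : (fun x => - x) = (fun=> -1) \* id by apply/funext => x /=; rewrite mulN1r.
by apply: lg_mul; [exact: lg_cst|exact: lg_id].
Qed.

(** Equal to 1 on [c - r, c + r] and to 0 outside [c - 2 r, c + 2 r]. *)
Definition plateau (c r : R) x :=
  smooth_step (2 - (x - c) / r) * smooth_step (2 + (x - c) / r).

Lemma plateau_smooth c r : smooth_line (plateau c r).
Proof.
apply: line_expr_smooth; have la a b : line_expr (fun x => a * x + b).
  apply: (lg_add (f := fun x => a * x) (g := fun=> b)); last exact: lg_cst.
  by apply: (lg_mul (f := fun=> a) (g := id)); [exact: lg_cst|exact: lg_id].
have ls a b : line_expr (fun x => smooth_step (a * x + b)).
  by apply: (lg_comp (f := smooth_step)); [exact: smooth_step_smooth|exact: la].
have -> : plateau c r = (fun x => smooth_step (- r^-1 * x + (2 + c / r))) \*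
    (fun x => smooth_step (r^-1 * x + (2 - c / r))).
  by apply/funext => x /=; rewrite /plateau; congr (smooth_step _ * smooth_step _); ring.
by apply: lg_mul; exact: ls.
Qed.

Lemma smooth_step_eq1 x : 1 <= x -> smooth_step x = 1.
Proof.
move=> x1; rewrite /smooth_step (@flat0_eq0 (1 - x)) ?addr0; last by lra.
by rewrite divff // gt_eqF // flat0_gt0 //; lra.
Qed.

Lemma smooth_step_eq0 x : x <= 0 -> smooth_step x = 0.
Proof. by move=> x0; rewrite /smooth_step flat0_eq0 // mul0r. Qed.

Lemma plateau_eq1 c r x : 0 < r -> `|x - c| <= r -> plateau c r x = 1.
Proof.
move=> r0; have E : (x - c) / r * r = x - c by rewrite divfK // gt_eqF.
rewrite -{1}E /plateau; move: ((x - c) / r) => z.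
rewrite normrM [`|r|]gtr0_norm // -[X in _ <= X]mul1r ler_pM2r // ler_norml.
by move=> /andP[? ?]; rewrite !smooth_step_eq1 ?mulr1 //; lra.
Qed.

Lemma plateau_eq0 c r x : 0 < r -> 2 * r <= `|x - c| -> plateau c r x = 0.
Proof.
move=> r0; have E : (x - c) / r * r = x - c by rewrite divfK // gt_eqF.
rewrite -{1}E; rewrite /plateau; move: ((x - c) / r) => z.
rewrite normrM [`|r|]gtr0_norm // ler_pM2r // ler_normr => /orP[h|h].
  by rewrite (smooth_step_eq0 (x := 2 - z)) ?mul0r //; lra.
by rewrite (smooth_step_eq0 (x := 2 + z)) ?mulr0 //; lra.
Qed.
End SmoothLine.

(** * Smooth functions of several variables and bounded derivatives *)

Section SmoothSpace.
Context {R : realType} {n : nat}.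
Implicit Types (F G : 'rV[R]_n -> R) (x y v w : 'rV[R]_n) (i : 'I_n).

(** Directional derivatives are derivatives along lines, to which the one-variable
    results apply. *)
Lemma is_derive_lineP F x w (s d : R) :
  is_derive (s *: w + x) w F d <-> is_derive s (1 : R) (fun h : R => F (h *: w + x)) d.
Proof.
have E : (fun h : R => h^-1 *: ((F \o shift (s *: w + x)) (h *: w) - F (s *: w + x))) =
  (fun h : R => h^-1 *: (((fun h : R => F (h *: w + x)) \o shift s) (h *: (1 : R))
    - F (s *: w + x))).
  by apply/funext => h /=; rewrite [h%:A]mulr1 scalerDl addrA.
by split=> -[D <-]; apply: DeriveDef; move: D; rewrite /derivable /derive E.
Qed.

Lemma rV_continuousP F x : {for x, continuous F} <->
  forall e, 0 < e -> exists2 r, 0 < r &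
    forall y, (forall i, `|y 0 i - x 0 i| < r) -> `|F y - F x| < e.
Proof.
split=> [cF e e0|H].
  move/cvgrPdist_lt: cF => /(_ e e0) /nbhs_ballP [r /= r0 Hr].
  exists r => // y Hy; rewrite distrC; apply: Hr; split=> // i j.
  by rewrite ord1 /ball /= distrC.
apply/(@cvgrPdist_lt _ _ _ (nbhs x)) => e /H [r r0 Hr]; apply/nbhs_ballP; exists r => //= y [_ Hy].
by rewrite distrC; apply: Hr => i; rewrite distrC; exact: Hy.
Qed.

Lemma smooth_rV_coind (P : set ('rV[R]_n -> R)) :
  (forall F, P F -> continuous F /\
     forall i, exists2 F', P F' & forall x, is_derive x (delta_mx 0 i) F (F' x)) ->
  P `<=` @smooth_rV R n.
Proof.
move=> HP F PF s; have : P (partials s F).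
  elim: s => [//|i s IH] /=; have [_ /(_ i) [F' PF' D]] := HP _ IH.
  suff -> : 'D_(delta_mx 0 i) (partials s F) = F' by [].
  by apply/funext => x; have [_ ->] := D x.
move=> /HP [cF dF]; split=> // i x.
by have [F' _ /(_ x) []] := dF i.
Qed.

Lemma smooth_rV_continuous F : smooth_rV F -> continuous F.
Proof. by move=> /(_ [::]) []. Qed.

Lemma smooth_rV_partial F i : smooth_rV F -> smooth_rV ('D_(delta_mx 0 i) F).
Proof.
move=> sF s; have := sF (rcons s i).
by rewrite /partials foldr_rcons.
Qed.

Lemma smooth_rV_is_derive F i x :
  smooth_rV F -> is_derive x (delta_mx 0 i) F ('D_(delta_mx 0 i) F x).
Proof. by move=> /(_ [::]) [_ /(_ i x)] ?; exact: derivableP. Qed.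

Inductive rV_expr : ('rV[R]_n -> R) -> Prop :=
| rg_base F : smooth_rV F -> rV_expr F
| rg_line g i : smooth_line g -> rV_expr (fun v => g (v 0 i))
| rg_coord i : rV_expr (fun v => v 0 i)
| rg_cst c : rV_expr (fun=> c)
| rg_add F G : rV_expr F -> rV_expr G -> rV_expr (F \+ G)
| rg_mul F G : rV_expr F -> rV_expr G -> rV_expr (F \* G).

Lemma is_derive_coord (g : R -> R) i j x (dg : R) : is_derive (x 0 i) (1 : R) g dg ->
  is_derive x (delta_mx 0 j) (fun v : 'rV[R]_n => g (v 0 i)) (dg * (i == j)%:R).
Proof.
move=> D; rewrite -[x]add0r -(scale0r (delta_mx 0 j)); apply/is_derive_lineP.
under eq_fun => h do rewrite !mxE eqxx /=.
apply: (@is_derive_chain _ (fun h => h * (i == j)%:R + x 0 i) g).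
  exact: is_derive_affine.
by rewrite mul0r add0r.
Qed.

Lemma rV_expr_smooth F : rV_expr F -> smooth_rV F.
Proof.
apply: (smooth_rV_coind (P := rV_expr)) => {}F.
elim=> {F} [F sF|g i sg|i|c|F G gF [cF dF] gG [cG dG]|F G gF [cF dF] gG [cG dG]].
- split=> [|i]; first exact: smooth_rV_continuous.
  exists ('D_(delta_mx 0 i) F); last by move=> x; exact: smooth_rV_is_derive.
  exact/rg_base/smooth_rV_partial.
- split=> [x|j].
    apply: (@continuous_comp _ _ _ (fun v : 'rV[R]_n => v 0 i) g).
      exact: coord_continuous.
    by apply: is_derive_continuous; exact: smooth_line_is_derive.
  exists ((fun v : 'rV[R]_n => g^`()%classic (v 0 i)) \* (fun=> (i == j)%:R)).
    by apply: rg_mul; [apply: rg_line; exact: smooth_line_derive|exact: rg_cst].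
  by move=> x; apply: is_derive_coord; exact: smooth_line_is_derive.
- split=> [x|j]; first exact: coord_continuous.
  exists (fun=> (i == j)%:R); first exact: rg_cst.
  move=> x; rewrite -[(i == j)%:R]mul1r.
  exact: (@is_derive_coord id i j x 1 (is_derive_id _ _)).
- split=> [x|j]; first exact: cst_continuous.
  by exists (fun=> 0); [exact: rg_cst|move=> x; exact: is_derive_cst].
- split=> [x|j]; first by apply: continuousD; [exact: cF|exact: cG].
  have [F' gF' DF] := dF j; have [G' gG' DG] := dG j.
  by exists (F' \+ G'); [exact: rg_add|move=> x; exact: is_deriveD].
- split=> [x|j]; first by apply: continuousM; [exact: cF|exact: cG].
  have [F' gF' DF] := dF j; have [G' gG' DG] := dG j.
  exists ((F \* G') \+ (G \* F')); first by apply: rg_add; exact: rg_mul.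
  by move=> x; have := is_deriveM (DF x) (DG x).
Qed.

End SmoothSpace.

Section Nice.
Context {R : realType}.

Definition bounded_functional (T : Type) (p : (T -> R) -> R) :=
  exists M, forall a, `|p a| <= M.

(** A first order expansion whose remainder is quadratic, uniformly in the base
    point.  It implies the chain rule along curves, is preserved by sums, products
    and reindexing, and refers to no norm on the space of states [T -> R]. *)
Definition taylor (T : finType) (p : (T -> R) -> R) (p' : T -> (T -> R) -> R) :=
  exists K, forall (a d : T -> R) (r : R), 0 <= r -> (forall i, `|d i| <= r) ->
    `|p (a \+ d) - p a - \sum_i p' i a * d i| <= K * r ^+ 2.

(** Boundedness of all the derivatives, stated coinductively.  States are
    functions on a finite type, so that a tangent vector with its base point is a
    state on [T + T]. *)
Definition tame (T : finType) (p : (T -> R) -> R) :=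
  exists2 P : set ((T -> R) -> R), P p & forall g, P g ->
    bounded_functional g /\ exists2 g', forall i, P (g' i) & taylor g g'.

Definition lipschitz_functional (T : Type) (p : (T -> R) -> R) :=
  exists L, forall (a b : T -> R) r, 0 <= r -> (forall i, `|b i - a i| <= r) ->
    `|p b - p a| <= L * r.

Lemma tame_bounded (T : finType) (p : (T -> R) -> R) : tame p -> bounded_functional p.
Proof. by case=> P Pp /(_ _ Pp) []. Qed.

Lemma tame_derivative (T : finType) (p : (T -> R) -> R) : tame p ->
  exists2 p', forall i, tame (p' i) & taylor p p'.
Proof.
case=> P Pp HP; have [_ [p' Pp' Tp]] := HP _ Pp.
by exists p' => // i; exists P.
Qed.

Lemma sum_bound (I : finType) (F D : I -> R) (M : I -> R) r :
  (forall i, `|F i| <= M i) -> (forall i, `|D i| <= r) ->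
  `|\sum_i F i * D i| <= (\sum_i M i) * r.
Proof.
move=> HF HD; apply: le_trans (ler_norm_sum _ _ _) _.
rewrite mulr_suml; apply: ler_sum => i _; rewrite normrM.
by apply: ler_pM.
Qed.

(** For increments at most 1 this is the expansion; for larger ones it follows
    from boundedness. *)
Lemma taylor_lipschitz (T : finType) (p : (T -> R) -> R) p' :
  bounded_functional p -> (forall i, bounded_functional (p' i)) -> taylor p p' ->
  lipschitz_functional p.
Proof.
move=> [M HM] /choice [M' HM'] [K HK].
exists (2 * M + \sum_i M' i + `|K|) => a b r r0 Hr.
have M0 : 0 <= M := le_trans (normr_ge0 _) (HM a).
have S0 : 0 <= \sum_i M' i.
  by apply: sumr_ge0 => i _; exact: le_trans (normr_ge0 _) (HM' i a).
have [r1|/ltW r1] := leP r 1.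
  have := HK a (b \- a) r r0 Hr.
  have -> : a \+ (b \- a) = b by apply/funext => i /=; rewrite addrC subrK.
  have h1 := @sum_bound T (fun i => p' i a) (b \- a) M' r (fun i => HM' i a) Hr.
  have h2 : K * r ^+ 2 <= `|K| * r.
    rewrite expr2 mulrA ler_wpM2r // ; apply: le_trans (ler_norm _) _.
    by rewrite normrM [`|r|]ger0_norm // ler_piMr.
  have h3 : 0 <= M * r by rewrite mulr_ge0.
  move: h1 => /=; set s := \sum_i _ * _ => h1 h4.
  have := ler_normD (p b - p a - s) s; rewrite subrK.
  lra.
have h := HM a; have h' := HM b.
have h2 : 0 <= (\sum_i M' i) * r by rewrite mulr_ge0.
have h3 : 0 <= `|K| * r by rewrite mulr_ge0.
have h4 : M <= M * r by rewrite ler_peMr.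
have := ler_normB (p b) (p a); lra.
Qed.

Lemma tame_lipschitz (T : finType) (p : (T -> R) -> R) :
  tame p -> lipschitz_functional p.
Proof.
move=> np; have [p' np' Tp] := tame_derivative np.
by apply: taylor_lipschitz Tp => [|i]; exact: tame_bounded.
Qed.

(** The closure under the operations that build the tangent field from a field
    and its derivatives. *)
Inductive tame_gen (T : finType) : ((T -> R) -> R) -> Prop :=
| ng_reindex (U : finType) (e : U -> T) p : tame p -> tame_gen (fun a => p (a \o e))
| ng_cst c : tame_gen (fun=> c)
| ng_add p q : tame_gen p -> tame_gen q -> tame_gen (fun a => p a + q a)
| ng_mul p q : tame_gen p -> tame_gen q -> tame_gen (fun a => p a * q a).

Lemma tame_gen_bounded (T : finType) (p : (T -> R) -> R) : tame_gen p -> bounded_functional p.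
Proof.
elim=> {p} [U e p /tame_bounded [M HM]|c|p q _ [M HM] _ [N HN]|p q _ [M HM] _ [N HN]].
- by exists M => a; exact: HM.
- by exists `|c| => a.
- by exists (M + N) => a; apply: le_trans (ler_normD _ _) _; exact: lerD.
- by exists (M * N) => a; rewrite normrM ler_pM.
Qed.

Lemma tame_gen_sum (T I : finType) (P : pred I) (F : I -> (T -> R) -> R) :
  (forall i, tame_gen (F i)) -> tame_gen (fun a => \sum_(i | P i) F i a).
Proof.
move=> HF; elim: (index_enum I) => [|i s IH].
  by under eq_fun => a do rewrite big_nil; exact: ng_cst.
under eq_fun => a do rewrite big_cons.
by case: (P i) => //; exact: ng_add.
Qed.

(** The coinductive family is the closure itself. *)
Lemma tame_gen_tame (T : finType) (p : (T -> R) -> R) : tame_gen p -> tame p.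
Proof.
move=> gp; exists (@tame_gen T) => // {gp}p gp; split; first exact: tame_gen_bounded.
elim: gp => {p} [U e p np|c|p q gp [p' gp' Tp] gq [q' gq' Tq]|
  p q gp [p' gp' Tp] gq [q' gq' Tq]].
- have [p' np' [K HK]] := tame_derivative np.
  exists (fun i a => \sum_(u | e u == i) p' u (a \o e)).
    move=> i; apply: (@tame_gen_sum T U _ (fun u a => p' u (a \o e))) => u.
    exact: ng_reindex.
  exists K => a d r r0 Hr; have := HK (a \o e) (d \o e) r r0 (fun i => Hr (e i)).
  rewrite (partition_big e xpredT) //=.
  congr (`|_ - _| <= _); apply: eq_bigr => i _.
  by rewrite mulr_suml; apply: eq_bigr => u /eqP ->.
- exists (fun _ _ => 0); first by move=> i; exact: ng_cst.
  exists 0 => a d r r0 Hr.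
  by rewrite big1 ?subrr ?subr0 ?normr0 ?mul0r // => i _; rewrite mul0r.
- exists (fun i a => p' i a + q' i a); first by move=> i; exact: ng_add.
  case: Tp Tq => [K HK] [K' HK']; exists (K + K') => a d r r0 Hr.
  have h := HK a d r r0 Hr; have h' := HK' a d r r0 Hr.
  under eq_bigr => i _ do rewrite mulrDl.
  rewrite big_split /= mulrDl.
  apply: le_trans (lerD h h'); apply: le_trans (ler_normD _ _).
  by rewrite le_eqVlt; apply/orP; left; apply/eqP; congr (`|_|); ring.
- exists (fun i a => p' i a * q a + p a * q' i a).
    by move=> i; apply: ng_add; apply: ng_mul.
  have [Lp HLp] := taylor_lipschitz (tame_gen_bounded gp)
    (fun i => tame_gen_bounded (gp' i)) Tp.
  have [Lq HLq] := taylor_lipschitz (tame_gen_bounded gq)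
    (fun i => tame_gen_bounded (gq' i)) Tq.
  have [M HM] := tame_gen_bounded gp; have [N HN] := tame_gen_bounded gq.
  case: Tp Tq => [K HK] [K' HK'].
  (* The three terms bound q times the remainder of p, p times that of q, and the
     product of the increments of p and q. *)
  exists (N * K + M * K' + Lp * Lq) => a d r r0 Hr.
  have h := HK a d r r0 Hr; have h' := HK' a d r r0 Hr.
  have ad i : `|(a \+ d) i - a i| <= r by rewrite /= addrAC subrr add0r.
  have l := HLp a (a \+ d) r r0 ad; have l' := HLq a (a \+ d) r r0 ad.
  have -> : \sum_i (p' i a * q a + p a * q' i a) * d i =
      q a * (\sum_i p' i a * d i) + p a * (\sum_i q' i a * d i).
    rewrite !mulr_sumr -big_split /=; apply: eq_bigr => i _; ring.
  move: h h' l l'; set S := \sum_i _; set S' := \sum_i _ => h h' l l'.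
  have -> : p (a \+ d) * q (a \+ d) - p a * q a - (q a * S + p a * S') =
    q a * (p (a \+ d) - p a - S) + p a * (q (a \+ d) - q a - S') +
    (p (a \+ d) - p a) * (q (a \+ d) - q a) by ring.
  have -> : (N * K + M * K' + Lp * Lq) * r ^+ 2 =
    N * (K * r ^+ 2) + M * (K' * r ^+ 2) + (Lp * r) * (Lq * r) by ring.
  apply: le_trans (ler_normD _ _) _; apply: lerD; last by rewrite normrM ler_pM.
  apply: le_trans (ler_normD _ _) _; rewrite !normrM.
  by apply: lerD; rewrite ler_pM.
Qed.

End Nice.

(** * Compactly supported smooth functions *)

Section CompactSupport.
Context {R : realType} {n : nat}.
Implicit Types (F : 'rV[R]_n -> R) (i j : 'I_n).

Definition box_supported (r : R) F := forall (v : 'rV[R]_n) i, r < `|v 0 i| -> F v = 0.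

Lemma box_supported_partial r F j :
  box_supported r F -> box_supported r ('D_(delta_mx 0 j) F).
Proof.
move=> sF v i rv; rewrite (@near_eq_derive _ _ _ F (cst 0)); first by rewrite derive_cst.
apply/nbhs_ballP; exists (`|v 0 i| - r) => /=; first by rewrite subr_gt0.
move=> y [_ /(_ 0 i)]; rewrite /ball /= => vy; apply: (sF _ i).
by have := ler_normD (v 0 i - y 0 i) (y 0 i); rewrite subrK; lra.
Qed.

Lemma box_supported_bounded r F : 0 <= r -> continuous F -> box_supported r F ->
  exists M, forall v, `|F v| <= M.
Proof.
move=> r0 cF sF; pose A := [set v : 'rV[R]_n | forall i, `[- r, r]%classic (v ord0 i)].
have cA : compact A.
  apply: (@rV_compact R n (fun=> `[- r, r]%classic)) => i; exact: segment_compact.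
have A0 : A !=set0 by exists 0 => i; rewrite /= mxE in_itv /=; lra.
have cN : {within A, continuous (fun v => `|F v|)}.
  apply: continuous_subspaceT => v; apply: continuous_comp; first exact: cF.
  exact: norm_continuous.
have [c _ Hc] := EVT_max_rV A0 cA cN.
exists `|F c| => v; have [Av|nAv] := pselect (A v); first exact/Hc/mem_set.
have [i /negP vi] : exists i, ~ `[- r, r]%classic (v ord0 i) by apply/existsNP.
rewrite (sF v i) ?normr0 //; move: vi; rewrite /= in_itv /= -ler_norml.
by rewrite -ltNge.
Qed.

(** The increment is split into increments along the coordinate axes, to each of
    which the one-variable mean value theorem applies. *)
Lemma telescope_mvt F (a d : 'I_n -> R) : smooth_rV F ->
  exists2 x : 'I_n -> 'rV[R]_n, (forall j i, `|x j 0 i - a i| <= `|d i|) &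
    F (\row_i (a i + d i)) - F (\row_i a i) =
    \sum_j 'D_(delta_mx 0 j) F (x j) * d j.
Proof.
move=> sF; pose p (k : nat) : 'rV[R]_n := \row_i (a i + (i < k)%:R * d i).
have step j : exists x : 'rV[R]_n, (forall i, `|x 0 i - a i| <= `|d i|) /\
    F (p j.+1) - F (p j) = 'D_(delta_mx 0 j) F x * d j.
  have [|c cd] := @mvt_seg _ (fun h : R => F (h *: delta_mx 0 j + p j))
      (fun h => 'D_(delta_mx 0 j) F (h *: delta_mx 0 j + p j)) 0 (d j).
    by move=> h _; apply/is_derive_lineP; exact: smooth_rV_is_derive.
  rewrite scale0r add0r subr0 => E; exists (c *: delta_mx 0 j + p j); split.
    move=> i; rewrite !mxE eqxx /=.
    have [->|ij] := eqVneq i j.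
      rewrite ltnn mul0r addr0 mulr1 addrK.
      by move: cd; case: (leP 0 (d j)) => d0 /andP[? ?]; rewrite ler_norml;
        [rewrite ger0_norm|rewrite ltr0_norm] => //; lra.
    rewrite mulr0 add0r addrAC subrr add0r normrM.
    by case: (i < j)%N; rewrite ?normr1 ?normr0 ?mul1r ?mul0r.
  rewrite -E; congr (F _ - _); apply/rowP => i; rewrite !mxE eqxx /=.
  rewrite ltnS leq_eqVlt; have [->|ij] := eqVneq i j.
    by rewrite eqxx ltnn /=; ring.
  by rewrite (negbTE (_ : val i != val j)) //= mulr0 add0r.
have [x Hx] := choice step; exists x => [j i|]; first by have [] := Hx j.
under eq_bigr => j _ do rewrite -(Hx j).2.
rewrite -(big_mkord xpredT (fun k => F (p k.+1) - F (p k))) telescope_sumr //.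
congr (F _ - F _); apply/rowP => i; rewrite !mxE ?ltn_ord ?mul1r //.
by rewrite ltn0 mul0r addr0.
Qed.

(** Partial derivatives of F are supported in the same box, hence bounded.  The
    telescoped mean value theorem applied to F gives the expansion, with error
    controlled by the same theorem applied to the partial derivatives. *)
Lemma tame_of_compact r F : 0 <= r -> smooth_rV F -> box_supported r F ->
  tame (fun a : 'I_n -> R => F (\row_i a i)).
Proof.
move=> r0 sF suF.
pose P : set (('I_n -> R) -> R) := [set p | exists G,
  [/\ smooth_rV G, box_supported r G & p = fun a => G (\row_i a i)]].
have bnd (G : 'rV[R]_n -> R) : smooth_rV G -> box_supported r G -> exists M, forall v, `|G v| <= M.
  by move=> sG; apply: box_supported_bounded => //; exact: smooth_rV_continuous.
have dS (G : 'rV[R]_n -> R) j : smooth_rV G -> smooth_rV ('D_(delta_mx 0 j) G).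
  by move=> sG; exact: smooth_rV_partial.
have lip (G : 'rV[R]_n -> R) : smooth_rV G -> box_supported r G ->
    lipschitz_functional (fun a : 'I_n -> R => G (\row_i a i)).
  move=> sG suG.
  have [M HM] := choice (fun j => bnd _ (dS G j sG) (@box_supported_partial r G j suG)).
  exists (\sum_j M j) => a b e e0 Hab.
  have [x _] := @telescope_mvt G a (b \- a) sG.
  have -> : \row_i (a i + (b \- a) i) = \row_i b i.
    by apply/rowP => i; rewrite !mxE /= addrC subrK.
  by move=> ->; apply: (sum_bound (D := b \- a)) => // j; exact: HM.
exists P; first by exists F.
move=> _ [G [sG suG ->]]; split.
  by have [M HM] := bnd _ sG suG; exists M => a; exact: HM.
exists (fun j a => 'D_(delta_mx 0 j) G (\row_i a i)) => [j|].
  by exists ('D_(delta_mx 0 j) G); split; [exact: dS|exact: box_supported_partial|by []].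
have [L HL] := choice (fun j => lip _ (dS G j sG) (@box_supported_partial r G j suG)).
exists (\sum_j L j) => a d e e0 Hd.
have [x x1 E] := @telescope_mvt G a d sG.
rewrite [X in X - _]E -sumrB; under eq_bigr => j _ do rewrite -mulrBl.
apply: le_trans (ler_norm_sum _ _ _) _; rewrite mulr_suml; apply: ler_sum => j _.
rewrite normrM expr2 mulrA; apply: ler_pM => //.
have -> : x j = \row_i x j 0 i by apply/rowP => i; rewrite mxE.
by apply: HL => // i; apply: le_trans (x1 j i) (Hd i).
Qed.

End CompactSupport.

(** * Euler approximations of a flow *)

Section GeometricLimit.
Context {R : realType}.

Lemma half_pow_small (C e : R) : 0 < e ->
  exists K, forall k, (K <= k)%N -> C / 2 ^+ k <= e.
Proof.
move=> e0; exists (Num.bound (C / e)) => k Kk.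
rewrite ler_pdivrMr ?exprn_gt0 // mulrC -ler_pdivrMr //.
exact/ltW/upper_nthrootP.
Qed.

(** The sequence u_k - 2 C / 2^k is nondecreasing and bounded, hence converges. *)
Lemma geometric_limit (u : nat -> R) C :
  (forall k, `|u k.+1 - u k| <= C / 2 ^+ k) ->
  forall k, `|u k - lim (u @ \oo)| <= 2 * C / 2 ^+ k.
Proof.
move=> H.
have H2 k m : `|u (k + m)%N - u k| <= 2 * C / 2 ^+ k - 2 * C / 2 ^+ (k + m).
  elim: m => [|m IH]; first by rewrite addn0 !subrr normr0.
  rewrite addnS; have := H (k + m)%N; rewrite exprS.
  have -> : 2 * C / (2 * 2 ^+ (k + m)) = C / 2 ^+ (k + m).
    by rewrite -mulf_div divff ?mul1r // pnatr_eq0.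
  move: IH; have -> : 2 * C / 2 ^+ (k + m) = C / 2 ^+ (k + m) + C / 2 ^+ (k + m) by ring.
  have := ler_normD (u (k + m).+1 - u (k + m)%N) (u (k + m)%N - u k).
  by rewrite addrA subrK; lra.
have C0 : 0 <= C by have := H 0%N; rewrite expr0 divr1; exact: le_trans (normr_ge0 _).
pose v k := u k - 2 * C / 2 ^+ k.
have vnd : nondecreasing_seq v.
  move=> k m km; rewrite /v -(subnKC km); have := H2 k (m - k)%N.
  by rewrite ler_norml; lra.
have vub m : v m <= u 0%N + 2 * C.
  rewrite /v; have := H2 0%N m; rewrite add0n expr0 divr1 ler_norml.
  have : 0 <= 2 * C / 2 ^+ m by rewrite divr_ge0 ?mulr_ge0 ?exprn_ge0.
  lra.
have cv : cvgn v.
  apply: nondecreasing_is_cvgn => //; exists (u 0%N + 2 * C) => _ [m _ <-]; exact: vub.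
have c0 : (fun k => 2 * C / 2 ^+ k) @ \oo --> (0 : R).
  apply/cvgrPdist_le => e /(half_pow_small (2 * C)) [K HK].
  exists K => // k /= Kk; rewrite sub0r normrN ger0_norm; first exact: HK.
  by rewrite divr_ge0 ?mulr_ge0 ?exprn_ge0.
have cu : u @ \oo --> lim (v @ \oo).
  have -> : u = v \+ (fun k => 2 * C / 2 ^+ k) by apply/funext => k; rewrite /v /= subrK.
  by rewrite -[X in _ --> X]addr0; apply: cvgD.
move=> k; rewrite (cvg_lim _ cu) //; apply/ler_addgt0Pl => e e0.
move/cvgrPdist_le: cu => /(_ _ e0) [K _ HK].
have := HK (k + K)%N (leq_addl _ _) => h.
have := H2 k K; have : 0 <= 2 * C / 2 ^+ (k + K) by rewrite divr_ge0 ?mulr_ge0 ?exprn_ge0.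
move: h; rewrite !ler_norml; lra.
Qed.

End GeometricLimit.

Section Euler.
Context {R : realType}.
Implicit Types (T : finType).

Definition euler_step T (G : T -> (T -> R) -> R) (h : R) (a : T -> R) : T -> R :=
  fun i => a i + h * G i a.

(** Passing from k to k + 1 replaces each step by two steps of half the length, which
    makes consecutive approximations comparable step by step. *)
Definition euler T (G : T -> (T -> R) -> R) (t : R) (k : nat) : (T -> R) -> T -> R :=
  iter (2 ^ k) (euler_step G (t / 2 ^+ k)).

Definition flow_limit T (G : T -> (T -> R) -> R) (t : R) (a : T -> R) (i : T) : R :=
  lim (euler G t k a i @[k --> \oo]).

Section Estimates.
Context {T : finType}.
Variables (G : T -> (T -> R) -> R) (M L : R).
Hypothesis M0 : 0 <= M.
Hypothesis L0 : 0 <= L.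
Hypothesis GM : forall i a, `|G i a| <= M.
Hypothesis GL : forall i (a b : T -> R) r, 0 <= r ->
  (forall j, `|b j - a j| <= r) -> `|G i b - G i a| <= L * r.

Lemma euler_step_lipschitz h a b r : 0 <= r -> (forall j, `|b j - a j| <= r) ->
  forall j, `|euler_step G h b j - euler_step G h a j| <= (1 + `|h| * L) * r.
Proof.
move=> r0 H j; rewrite /euler_step.
have -> : b j + h * G j b - (a j + h * G j a) = (b j - a j) + h * (G j b - G j a) by ring.
apply: le_trans (ler_normD _ _) _; rewrite mulrDl mul1r; apply: lerD => //.
by rewrite normrM -mulrA ler_wpM2l // GL.
Qed.

(** Discrete Gronwall inequality: an error c made at one step grows by a factor of
    at most 1 + |h| L at each later step.  The sequence x will be the Euler
    approximation with half the step, and also a solution sampled at the times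
    j h. *)
Lemma euler_pseudo_orbit h c (x : nat -> T -> R) N :
  (forall j i, (j < N)%N -> `|x j.+1 i - euler_step G h (x j) i| <= c) ->
  forall i, `|x N i - iter N (euler_step G h) (x 0%N) i| <= N%:R * c * (1 + `|h| * L) ^+ N.
Proof.
have q1 : 1 <= 1 + `|h| * L by rewrite lerDl mulr_ge0.
elim: N => [|N IH] H i; first by rewrite /= subrr normr0 mul0r mul0r.
have c0 : 0 <= c by exact: le_trans (normr_ge0 _) (H 0%N i (ltn0Sn _)).
have IH' := IH (fun j i jN => H j i (ltnW jN)).
have r0 : 0 <= N%:R * c * (1 + `|h| * L) ^+ N.
  by rewrite !mulr_ge0 // exprn_ge0 //; lra.
rewrite iterS; set y := iter N _ _ in IH' *.
have h1 := H N i (ltnSn N).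
have h2 := @euler_step_lipschitz h y (x N) _ r0 IH' i.
have -> : x N.+1 i - euler_step G h y i = (x N.+1 i - euler_step G h (x N) i) +
  (euler_step G h (x N) i - euler_step G h y i) by ring.
apply: le_trans (ler_normD _ _) _; apply: le_trans (lerD h1 h2) _.
have -> : N.+1%:R * c * (1 + `|h| * L) ^+ N.+1 = c * (1 + `|h| * L) ^+ N.+1 +
  (1 + `|h| * L) * (N%:R * c * (1 + `|h| * L) ^+ N) by rewrite -natr1 exprS; ring.
by rewrite lerD2r ler_peMr // exprn_ege1.
Qed.

Lemma euler_factor t k : (1 + `|t / 2 ^+ k| * L) ^+ (2 ^ k)%N <= expR (`|t| * L).
Proof.
have p0 : 0 < 2 ^+ k :> R by rewrite exprn_gt0.
rewrite normrM normfV [`|2 ^+ k|]gtr0_norm //.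
have -> : `|t| * L = (2 ^ k)%N%:R * (`|t| / 2 ^+ k * L).
  by rewrite natrX; field; rewrite gt_eqF.
rewrite expRM_natl; apply: lerXn2r; rewrite ?nnegrE ?expR_ge0 //.
  by apply: addr_ge0 => //; apply: mulr_ge0.
exact: expR_ge1Dx.
Qed.

Definition euler_rate t := M * L * t ^+ 2 * expR (`|t| * L).

Lemma euler_pseudo_orbit_rate t k (x : nat -> T -> R) :
  (forall j i, (j < 2 ^ k)%N ->
    `|x j.+1 i - euler_step G (t / 2 ^+ k) (x j) i| <= M * L * (t / 2 ^+ k) ^+ 2) ->
  forall i, `|x (2 ^ k)%N i - euler G t k (x 0%N) i| <= euler_rate t / 2 ^+ k.
Proof.
move=> H i; apply: le_trans (euler_pseudo_orbit H i) _.
have p0 : 0 < 2 ^+ k :> R by rewrite exprn_gt0.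
have -> : (2 ^ k)%N%:R * (M * L * (t / 2 ^+ k) ^+ 2) = M * L * t ^+ 2 / 2 ^+ k.
  by rewrite natrX; field; rewrite gt_eqF.
rewrite /euler_rate mulrAC ler_pM2r ?invr_gt0 // ler_wpM2l //.
  by apply: mulr_ge0; [exact: mulr_ge0|exact: sqr_ge0].
exact: euler_factor.
Qed.

(** One step h and two steps h / 2 from y differ by
    h / 2 * (G (y + h / 2 * G y) - G y), which is of order h^2. *)
Lemma euler_refine t k a i :
  `|euler G t k.+1 a i - euler G t k a i| <= euler_rate t / 2 ^+ k.
Proof.
pose x j := iter (2 * j)%N (euler_step G (t / 2 ^+ k.+1)) a.
have -> : euler G t k.+1 a = x (2 ^ k)%N by rewrite /euler /x expnS.
apply: (@euler_pseudo_orbit_rate t k x) => {}i j _.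
have p0 : 0 < 2 ^+ k :> R by rewrite exprn_gt0.
set h := t / 2 ^+ k; have -> : x i.+1 = euler_step G (h / 2) (euler_step G (h / 2) (x i)).
  rewrite /x mulnS !iterD /=; congr (euler_step G _ (euler_step G _ _));
  by rewrite /h exprS; field; rewrite gt_eqF.
set y := x i.
have -> : euler_step G (h / 2) (euler_step G (h / 2) y) j - euler_step G h y j =
  h / 2 * (G j (euler_step G (h / 2) y) - G j y).
  by rewrite /euler_step; field.
rewrite normrM; have b0 : 0 <= `|h / 2| * M by rewrite mulr_ge0.
have := @GL j y (euler_step G (h / 2) y) _ b0.
have H l : `|euler_step G (h / 2) y l - y l| <= `|h / 2| * M.
  by rewrite /euler_step addrAC subrr add0r normrM ler_wpM2l.
move=> /(_ H) h1; apply: le_trans (ler_wpM2l (normr_ge0 _) h1) _.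
have -> : `|h / 2| * (L * (`|h / 2| * M)) = M * L * (`|h / 2| * `|h / 2|) by ring.
rewrite -normrM ger0_norm; last by rewrite -expr2 sqr_ge0.
rewrite ler_wpM2l ?mulr_ge0 //.
have -> : h / 2 * (h / 2) = h ^+ 2 / 4 by field.
by have := sqr_ge0 h; lra.
Qed.

Lemma flow_limit_rate t k a i :
  `|euler G t k a i - flow_limit G t a i| <= 2 * euler_rate t / 2 ^+ k.
Proof. by apply: geometric_limit => {}k; exact: euler_refine. Qed.

Lemma flow_limit_unique t a i l C :
  (forall k, `|l - euler G t k a i| <= C / 2 ^+ k) -> l = flow_limit G t a i.
Proof.
move=> H; apply/eqP; rewrite -subr_eq0 -normr_le0; apply/ler_addgt0Pl => e e0.
have [K HK] := half_pow_small (C + 2 * euler_rate t) e0.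
have := H K; have := flow_limit_rate t K a i; have := HK K (leqnn _).
rewrite addr0 mulrDl => h1 h2 h3.
have := ler_normD (l - euler G t K a i) (euler G t K a i - flow_limit G t a i).
by rewrite addrA subrK; lra.
Qed.

Lemma flow_limit_lipschitz t a b r : 0 <= r -> (forall j, `|b j - a j| <= r) ->
  forall i, `|flow_limit G t b i - flow_limit G t a i| <= expR (`|t| * L) * r.
Proof.
move=> r0 H i; apply/ler_addgt0Pl => e e0.
have [K HK] := half_pow_small (4 * euler_rate t) e0.
have S N h : forall j, `|iter N (euler_step G h) b j - iter N (euler_step G h) a j| <=
    (1 + `|h| * L) ^+ N * r.
  elim: N => [|N IH] j; first by rewrite mul1r; exact: H.
  rewrite !iterS exprS -mulrA; apply: euler_step_lipschitz => //.
  by rewrite mulr_ge0 // exprn_ge0 // addr_ge0 // mulr_ge0.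
have := S (2 ^ K)%N (t / 2 ^+ K) i.
have := ler_wpM2r r0 (euler_factor t K).
have := flow_limit_rate t K a i; have := flow_limit_rate t K b i; have := HK K (leqnn _).
have -> : 4 * euler_rate t / 2 ^+ K = 2 * euler_rate t / 2 ^+ K + 2 * euler_rate t / 2 ^+ K.
  by ring.
rewrite -/(euler G t K b i) -/(euler G t K a i) !ler_norml; lra.
Qed.

(** A step of length h along a solution differs from the Euler step by
    h (G (y c) - G (y s)) for an intermediate time c, again of order h^2.  Hence
    Euler's method converges to every solution that is given beforehand. *)
Lemma flow_limit_solution (y : R -> T -> R) (t0 t : R) :
  (forall s : R, Num.min t0 (t0 + t) <= s <= Num.max t0 (t0 + t) ->
     forall i, is_derive s (1 : R) (y ^~ i) (G i (y s))) ->
  forall i, y (t0 + t) i = flow_limit G t (y t0) i.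
Proof.
move=> H i; apply: (@flow_limit_unique _ _ _ _ (euler_rate t)) => k.
have p0 : 0 < 2 ^+ k :> R by rewrite exprn_gt0.
pose x j := y (t0 + j%:R * (t / 2 ^+ k)).
have := @euler_pseudo_orbit_rate t k x; rewrite /x mul0r addr0.
have -> : (2 ^ k)%N%:R * (t / 2 ^+ k) = t by rewrite natrX mulrC divfK // gt_eqF.
apply => j l jk.
set h := t / 2 ^+ k; set s := t0 + j%:R * h.
have sE : t0 + j.+1%:R * h = s + h by rewrite /s -natr1; ring.
rewrite sE.
have j0 : 0 <= j%:R / 2 ^+ k :> R by rewrite divr_ge0 // ltW.
have j1 : (j%:R + 1) / 2 ^+ k <= 1 :> R.
  by rewrite ler_pdivrMr // mul1r natr1 -natrX ler_nat.
have seg u : Num.min s (s + h) <= u <= Num.max s (s + h) ->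
    Num.min t0 (t0 + t) <= u <= Num.max t0 (t0 + t).
  have e1 : s = t0 + t * (j%:R / 2 ^+ k) by rewrite /s /h; ring.
  have e2 : s + h = t0 + t * ((j%:R + 1) / 2 ^+ k) by rewrite /s /h; ring.
  have e3 : (j%:R + 1) / 2 ^+ k = j%:R / 2 ^+ k + 1 / 2 ^+ k :> R by ring.
  have e4 : 0 < 1 / 2 ^+ k :> R by rewrite divr_gt0.
  rewrite e2 e1; move: j0 j1; rewrite e3.
  move: (j%:R / 2 ^+ k) (1 / 2 ^+ k) e4 => p q q0 p1 pq1.
  have [t_0|t_0] := leP 0 t.
    have a1 : 0 <= t * p by rewrite mulr_ge0.
    have a2 : 0 <= t * q by rewrite mulr_ge0 // ltW.
    have a3 : t * (p + q) <= t by rewrite ler_piMr.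
    rewrite mulrDr in a3 *.
    by rewrite (min_idPl _) ?(max_idPr _) ?(min_idPl _) ?(max_idPr _); lra.
  have a1 : t * p <= 0 by rewrite mulr_le0_ge0 // ltW.
  have a2 : t * q <= 0 by rewrite mulr_le0_ge0 // ltW.
  have a3 : t <= t * (p + q) by rewrite ler_niMr // ltW.
  rewrite mulrDr in a3 *.
  by rewrite (min_idPr _) ?(max_idPl _) ?(min_idPr _) ?(max_idPl _); lra.
have ys u m : Num.min s (s + h) <= u <= Num.max s (s + h) -> `|y u m - y s m| <= M * `|h|.
  move=> Hu; have hu : `|u - s| <= `|h|.
    by move: Hu; case: (leP s (s + h)) => ? /andP[? ?];
      case: (ger0P (u - s)) => ?; case: (ger0P h) => ?; lra.
  apply: le_trans (_ : M * `|u - s| <= _); last by rewrite ler_wpM2l.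
  apply: (@mvt_bound _ (y ^~ m) (fun s => G m (y s))) => v Hv; split => //.
  apply/H/seg; move: Hu Hv; case: (leP s (s + h)) => ? /andP[? ?];
    by case: (leP s u) => ? /andP[? ?]; lra.
have [|c cs] := @mvt_seg _ (y ^~ l) (fun s => G l (y s)) s (s + h).
  by move=> v Hv; apply/H/seg.
rewrite /euler_step; have -> : s + h - s = h by rewrite addrAC subrr add0r.
move=> E; have -> : y (s + h) l - (y s l + h * G l (y s)) =
  h * (G l (y c) - G l (y s)) by rewrite opprD addrA E; ring.
rewrite normrM; have b0 : 0 <= M * `|h| by rewrite mulr_ge0.
have h1 := @GL l (y s) (y c) _ b0 (fun m => ys c m cs).
apply: le_trans (ler_wpM2l (normr_ge0 _) h1) _.
have -> : `|h| * (L * (M * `|h|)) = M * L * (`|h| * `|h|) by ring.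
by rewrite -normrM ger0_norm // -expr2 sqr_ge0.
Qed.

End Estimates.
End Euler.

(** * Smooth dependence on the initial value *)

Section Tangent.
Context {R : realType}.

(** The derivatives of y bound its increments by a multiple of |t - s|, which makes
    the quadratic remainder negligible. *)
Lemma taylor_chain (T : finType) (p : (T -> R) -> R) p' (y : R -> T -> R) (v : T -> R) (s : R) :
  taylor p p' -> (forall j, is_derive s (1 : R) (y ^~ j) (v j)) ->
  is_derive s (1 : R) (fun s => p (y s)) (\sum_j p' j (y s) * v j).
Proof.
move=> [K HK] Dy; apply/is_derive_epsP => e e0.
pose V := \sum_j `|v j|; pose S := \sum_j `|p' j (y s)|.
have V0 : 0 <= V by apply: sumr_ge0.
have S0 : 0 <= S by apply: sumr_ge0.
(* The bound e / 2 / (S + 1) makes the errors of the components of y contribute at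
   most e / 2; the bound 1 makes their increments at most V + 1 times |t - s|. *)
pose e' := Num.min 1 (e / 2 / (S + 1)).
have e'0 : 0 < e' by rewrite lt_min ltr01 !divr_gt0 //; lra.
have K0 : 0 < `|K| * (V + 1) ^+ 2 + 1 by rewrite ltr_wpDl // mulr_ge0 // sqr_ge0.
pose r0 := e / 2 / (`|K| * (V + 1) ^+ 2 + 1).
have r00 : 0 < r0 by rewrite !divr_gt0.
have [r Hr] := choice (fun j => let: ex_intro2 r a b := (is_derive_epsP _ _ _).1 (Dy j) _ e'0
  in ex_intro (fun r => 0 < r /\ forall t, `|t - s| < r ->
     `|y t j - y s j - v j * (t - s)| <= e' * `|t - s|) r (conj a b)).
exists (\big[Num.min/r0]_j r j).
  by apply/bigmin_gtP; split=> // j _; have [] := Hr j.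
move=> t /bigmin_gtP [tr0 tr].
have Hj j : `|y t j - y s j - v j * (t - s)| <= e' * `|t - s|.
  by have [_] := Hr j; apply; exact: tr.
set d := `|t - s| in Hj tr0 *; have d0 : 0 <= d by exact: normr_ge0.
have vV j : `|v j| <= V by rewrite /V (bigD1 j) //= lerDl sumr_ge0.
have yd j : `|y t j - y s j| <= (V + 1) * d.
  have := ler_normD (y t j - y s j - v j * (t - s)) (v j * (t - s)).
  rewrite subrK normrM -/d => /le_trans; apply; rewrite mulrDl addrC mul1r.
  apply: lerD; first by rewrite ler_wpM2r.
  by apply: le_trans (Hj j) _; rewrite ler_piMl // ge_min lexx.
have := HK (y s) (fun j => y t j - y s j) ((V + 1) * d).
have -> : y s \+ (fun j => y t j - y s j) = y t by apply/funext => j /=; rewrite addrC subrK.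
move=> /(_ _ yd) h; have {}h : `|p (y t) - p (y s) - \sum_j p' j (y s) * (y t j - y s j)|
    <= e / 2 * d.
  apply: le_trans (h _) _; first by rewrite mulr_ge0 //; lra.
  rewrite exprMn mulrA [d ^+ 2]expr2 mulrA ler_wpM2r //.
  apply: (@le_trans _ _ ((`|K| * (V + 1) ^+ 2 + 1) * d)).
    rewrite ler_wpM2r //; apply: le_trans (ler_norm _) _.
    by rewrite normrM [`|_ ^+ 2|]ger0_norm ?sqr_ge0 // lerDl.
  by rewrite mulrC -ler_pdivlMr // ltW.
have h2 : `|\sum_j p' j (y s) * (y t j - y s j) - (\sum_j p' j (y s) * v j) * (t - s)|
    <= e / 2 * d.
  rewrite mulr_suml -sumrB.
  under eq_bigr => j _ do rewrite -mulrA -mulrBr.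
  apply: le_trans (sum_bound (fun j => lexx `|p' j (y s)|) Hj) _.
  rewrite -/S mulrA ler_wpM2r //.
  apply: (@le_trans _ _ (S * (e / 2 / (S + 1)))).
    by rewrite ler_wpM2l // ge_min lexx orbT.
  rewrite mulrA ler_pdivrMr ?ltr_wpDl // mulrC ler_wpM2l //; lra.
have := ler_normD (p (y t) - p (y s) - \sum_j p' j (y s) * (y t j - y s j))
  (\sum_j p' j (y s) * (y t j - y s j) - (\sum_j p' j (y s) * v j) * (t - s)).
by rewrite addrA subrK; lra.
Qed.

(** The tangent field is linear in the velocities, hence unbounded.  Truncating the
    velocities makes it bounded, and does not change it where they are at most r. *)
Definition truncation (r v : R) := v * plateau 0 r v.

Lemma truncation_tame (T : finType) (r : R) (i : T) : 0 < r ->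
  tame (fun a : T -> R => truncation r (a i)).
Proof.
move=> r0; apply: tame_gen_tame.
pose F (v : 'rV[R]_1) := truncation r (v 0 0).
have nF : tame (fun b : 'I_1 -> R => F (\row_j b j)).
  apply: (@tame_of_compact _ _ (2 * r)).
  - by rewrite mulr_ge0 // ltW.
  - apply: rV_expr_smooth.
    apply: (rg_mul (F := fun v : 'rV[R]_1 => v 0 0)); first exact: rg_coord.
    by apply: rg_line; exact: plateau_smooth.
  - move=> v j; rewrite /F ord1 /truncation => rv.
    by rewrite plateau_eq0 ?mulr0 // subr0 ltW.
have := ng_reindex (fun _ : 'I_1 => i) nF.
by rewrite /F; under eq_fun => a do rewrite mxE /=.
Qed.

Definition tangent_field (T : finType) (G : T -> (T -> R) -> R)
    (G' : T -> T -> (T -> R) -> R) (r : R) (i : T + T) (a : T + T -> R) : R :=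
  match i with
  | inl i => G i (a \o inl)
  | inr i => \sum_j G' i j (a \o inl) * truncation r (a (inr j))
  end.

Lemma tangent_field_tame (T : finType) (G : T -> (T -> R) -> R)
    (G' : T -> T -> (T -> R) -> R) (r : R) : 0 < r ->
  (forall i, tame (G i)) -> (forall i j, tame (G' i j)) ->
  forall i, tame (tangent_field G G' r i).
Proof.
move=> r0 nG nG' [i|i]; apply: tame_gen_tame; first exact: ng_reindex.
apply: (@tame_gen_sum _ _ T xpredT
  (fun j (a : T + T -> R) => G' i j (a \o inl) * truncation r (a (inr j)))) => j.
apply: (ng_mul (p := fun a : T + T -> R => G' i j (a \o inl))); first exact: ng_reindex.
by apply: (ng_reindex id (truncation_tame (inr j) r0)).
Qed.

Definition tangent_state (T : finType) (a w : T -> R) (i : T + T) : R :=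
  match i with inl i => a i | inr i => w i end.

Lemma bounds_uniform (I J : finType) (P : I -> J -> R -> Prop) :
  (forall i j M N, M <= N -> P i j M -> P i j N) ->
  (forall i j, exists M, P i j M) -> exists2 M, 0 <= M & forall i j, P i j M.
Proof.
move=> mono H; have [f Hf] := choice (fun ij : I * J => H ij.1 ij.2).
exists (\sum_ij `|f ij|); first exact: sumr_ge0.
move=> i j; apply: mono (Hf (i, j)); apply: le_trans (ler_norm _) _.
by rewrite (bigD1 (i, j)) //= lerDl sumr_ge0.
Qed.

Lemma tame_field_bounds (T : finType) (G : T -> (T -> R) -> R) :
  (forall i, tame (G i)) -> exists M L, [/\ 0 <= M, 0 <= L,
    forall i a, `|G i a| <= M & forall i (a b : T -> R) r, 0 <= r ->
      (forall j, `|b j - a j| <= r) -> `|G i b - G i a| <= L * r].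
Proof.
move=> nG.
have [|i _|M M0 HM] := @bounds_uniform T unit (fun i _ M => forall a, `|G i a| <= M).
- by move=> i _ M N MN H a; exact: le_trans (H a) MN.
- exact/tame_bounded/nG.
have [|i _|L L0 HL] := @bounds_uniform T unit (fun i _ L => forall (a b : T -> R) r, 0 <= r ->
      (forall j, `|b j - a j| <= r) -> `|G i b - G i a| <= L * r).
- by move=> i _ M' N MN H a b r r0 ab; apply: le_trans (H a b r r0 ab) _; rewrite ler_wpM2r.
- exact/tame_lipschitz/nG.
by exists M, L; split=> // i; [exact: (HM i tt)|exact: (HL i tt)].
Qed.

(** Differentiation along w commutes with Euler steps: the derivative of an Euler
    approximation is the velocity part of the Euler approximation for the tangent
    field.  Along it velocities grow by a factor of at most expR (|t| L), so that
    the truncation at r has no effect. *)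
Lemma euler_tangent (T : finType) (G : T -> (T -> R) -> R) G' (W L t : R) :
  (forall i, taylor (G i) (G' i)) -> 0 <= L -> 0 <= W ->
  (forall i a (x : T -> R) r, (forall j, `|x j| <= r) -> `|\sum_j G' i j a * x j| <= L * r) ->
  forall r, W * expR (`|t| * L) <= r -> 0 < r ->
  forall (a w : T -> R), (forall i, `|w i| <= W) -> forall k (s : R),
  let E := euler (tangent_field G G' r) t k (tangent_state (fun i => a i + s * w i) w) in
  (forall i, E (inl i) = euler G t k (fun i => a i + s * w i) i) /\
  (forall i, is_derive s (1 : R) (fun s => euler G t k (fun i => a i + s * w i) i) (E (inr i))).
Proof.
move=> TG L0 W0 GL r Wr r0 a w wW k s /=; rewrite /euler.
set h := t / 2 ^+ k; set N := (2 ^ k)%N.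
pose E j := iter j (euler_step (tangent_field G G' r) h) (tangent_state (fun i => a i + s * w i) w).
pose e s j := iter j (euler_step G h) (fun i => a i + s * w i).
have q1 : 1 <= 1 + `|h| * L by rewrite lerDl mulr_ge0.
suff /(_ N (leqnn _)) [? _ ?] : forall j, (j <= N)%N -> [/\ forall i, E j (inl i) = e s j i,
    forall i, `|E j (inr i)| <= W * (1 + `|h| * L) ^+ j &
    forall i, is_derive s (1 : R) (fun s => e s j i) (E j (inr i))] by [].
elim=> [_|j IH jN]; first split=> [//|i|i].
- by rewrite expr0 mulr1; exact: wW.
- rewrite /e /E /=; have := is_derive_affine (w i) (a i) s.
  by apply: eq_is_derive => x; rewrite mulrC addrC.
have [IH1 IH2 IH3] := IH (ltnW jN).
have EE : E j \o inl = e s j by apply/funext => i; exact: IH1.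
have tr i : truncation r (E j (inr i)) = E j (inr i).
  rewrite /truncation plateau_eq1 ?mulr1 // subr0; apply: le_trans Wr.
  apply: le_trans (IH2 i) _; rewrite ler_wpM2l //.
  by apply: le_trans (euler_factor L0 t k); rewrite ler_weXn2l // ltnW.
have ER i : E j.+1 (inr i) = E j (inr i) + h * \sum_l G' i l (e s j) * E j (inr l).
  rewrite /E /= -/(E j) /euler_step /=; congr (_ + h * _).
  by apply: eq_bigr => l _; rewrite EE tr.
split=> i.
- by rewrite /E /= -/(E j) /euler_step /= EE IH1.
- rewrite ER exprS mulrCA mulrDl mul1r; apply: le_trans (ler_normD _ _) _.
  apply: lerD => //; rewrite normrM -mulrA ler_wpM2l //.
  exact: GL.
- rewrite ER; have Dc := taylor_chain (TG i) IH3.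
  have := is_deriveD (IH3 i) (is_deriveZ h Dc).
  by apply: eq_is_derive.
Qed.

(** Both the Euler approximations and their derivatives converge uniformly.  The
    field [G1] does not depend on the base point [a], so the right-hand side is, as
    a function of the base point, a function of the same kind. *)
Lemma flow_limit_derive (T : finType) (G : T -> (T -> R) -> R) (t : R) (w : T -> R) :
  (forall i, tame (G i)) -> exists2 G1 : T + T -> (T + T -> R) -> R,
  forall i, tame (G1 i) & forall (a : T -> R) i (s : R),
    is_derive s (1 : R) (fun s => flow_limit G t (fun i => a i + s * w i) i)
      (flow_limit G1 t (tangent_state (fun i => a i + s * w i) w) (inr i)).
Proof.
move=> nG; have H i : exists G'i, (forall j, tame (G'i j)) /\ taylor (G i) G'i.
  by have [g ? ?] := tame_derivative (nG i); exists g.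
have [G' HG'] := choice H.
have [|i j|B B0 HB] := @bounds_uniform T T (fun i j M => forall a, `|G' i j a| <= M).
- by move=> i j M N MN b a; exact: le_trans (b a) MN.
- exact/tame_bounded/(HG' i).1.
pose L := \sum_(j : T) B; pose W := \sum_j `|w j|.
have L0 : 0 <= L by apply: sumr_ge0.
have W0 : 0 <= W by apply: sumr_ge0.
have wW i : `|w i| <= W by rewrite /W (bigD1 i) //= lerDl sumr_ge0.
(* A bound for the velocities up to time t; the summand 1 makes it positive. *)
pose r := W * expR (`|t| * L) + 1.
have r0 : 0 < r by rewrite ltr_wpDl // mulr_ge0 // expR_ge0.
have nG1 := tangent_field_tame r0 nG (fun i => (HG' i).1).
exists (tangent_field G G' r) => // a i s.
have [M [L1 [M0 L10 GM GL1]]] := tame_field_bounds nG.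
have [M' [L' [M'0 L'0 GM' GL']]] := tame_field_bounds nG1.
have GL i0 a0 (x : T -> R) d : (forall j, `|x j| <= d) -> `|\sum_j G' i0 j a0 * x j| <= L * d.
  by move=> xd; apply: sum_bound => // j.
have ET := @euler_tangent T G G' W L t (fun i => (HG' i).2) L0 W0 GL r _ r0 a w wW.
apply: (@is_derive_unif_lim _ (fun k s => euler G t k (fun i => a i + s * w i) i)
  (fun k s => euler (tangent_field G G' r) t k
    (tangent_state (fun i => a i + s * w i) w) (inr i)) _ 
  (fun s => flow_limit (tangent_field G G' r) t
    (tangent_state (fun i => a i + s * w i) w) (inr i)) (`|s| + 1)); last by lra.
  by move=> k x _; have [] := ET _ k x; rewrite ?lerDl.
move=> e e0.
have [K HK] := half_pow_small (2 * euler_rate M L1 t) e0.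
have [K' HK'] := half_pow_small (2 * euler_rate M' L' t) e0.
exists (maxn K K') => k; rewrite geq_max => /andP[Kk K'k] x _; split.
  by apply: le_trans (HK k Kk); exact: flow_limit_rate.
by apply: le_trans (HK' k K'k); exact: flow_limit_rate.
Qed.

(** The coinductive family consists of all limits of Euler approximations composed
    with affine maps: by [flow_limit_derive] a partial derivative is the limit for
    the tangent field, at the state formed by the affine map and its constant
    derivative. *)
Lemma flow_limit_smooth (n : nat) (G : 'I_n -> ('I_n -> R) -> R) (t : R) (i : 'I_n) :
  (forall i, tame (G i)) -> smooth_rV (fun y : 'rV[R]_n => flow_limit G t (fun j => y 0 j) i).
Proof.
move=> nG; pose P : set ('rV[R]_n -> R) := [set F | exists (T : finType)
  (H : T -> (T -> R) -> R) (b : T -> R) (A : T -> 'I_n -> R) (j : T),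
  (forall l, tame (H l)) /\
  F = fun y : 'rV[R]_n => flow_limit H t (fun l => b l + \sum_k A l k * y 0 k) j].
apply: (smooth_rV_coind (P := P)); last first.
  exists 'I_n, G, (fun=> 0), (fun l k => (k == l)%:R), i; split => //.
  apply/funext => y; congr (flow_limit _ _ _ _); apply/funext => l.
  rewrite add0r (bigD1 l) //= eqxx mul1r big1 ?addr0 // => k /negbTE ->.
  by rewrite mul0r.
move=> _ [T [H [b [A [j [nH ->]]]]]]; split.
  have [M [L [M0 L0 HM HL]]] := tame_field_bounds nH.
  move=> y; apply/rV_continuousP => e e0.
  have [|l k|B B0 HB] := @bounds_uniform T 'I_n (fun l k B => `|A l k| <= B).
  - by move=> l k M' N MN h; exact: le_trans h MN.
  - by exists `|A l k|.
  pose C := expR (`|t| * L) * (\sum_(k : 'I_n) B) + 1.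
  have C0 : 0 < C by rewrite ltr_wpDl // mulr_ge0 ?expR_ge0 // sumr_ge0.
  exists (e / C); first by rewrite divr_gt0.
  move=> z yz; have eC0 : 0 <= e / C by rewrite divr_ge0 // ltW.
  have := @flow_limit_lipschitz R T H M L M0 L0 HM HL t
    (fun l => b l + \sum_k A l k * y 0 k) (fun l => b l + \sum_k A l k * z 0 k)
    ((\sum_(k : 'I_n) B) * (e / C)).
  have S0 : 0 <= \sum_(k : 'I_n) B by apply: sumr_ge0.
  move=> /(_ (mulr_ge0 S0 eC0)) /(_ _ j) h; apply: le_lt_trans (h _) _.
    move=> l; rewrite opprD addrACA subrr add0r -sumrB.
    under eq_bigr => k _ do rewrite -mulrBr.
    by apply: sum_bound => // k; exact/ltW/yz.
  rewrite mulrA mulrA ltr_pdivrMr // mulrC ltr_pM2l //.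
  by rewrite /C ltrDl.
move=> k.
have [H1 nH1 DH] := flow_limit_derive t (fun l => A l k) nH.
exists (fun y : 'rV[R]_n => flow_limit H1 t
  (tangent_state (fun l => b l + \sum_k A l k * y 0 k) (fun l => A l k)) (inr j)).
  exists (T + T)%type, H1, (tangent_state b (fun l => A l k)),
    (fun l k => match l with inl l => A l k | inr _ => 0 end), (inr j); split => //.
  apply/funext => y; congr (flow_limit _ _ _ _); apply/funext => -[l|l] //=.
  by rewrite big1 ?addr0 // => ? _; rewrite mul0r.
move=> y; set F := fun y : 'rV[R]_n => _; set dF := flow_limit H1 _ _ _.
suff : is_derive (0 *: delta_mx 0 k + y) (delta_mx 0 k) F dF.
  by rewrite scale0r add0r.
have FE h : F (h *: delta_mx 0 k + y) =
    flow_limit H t (fun l => b l + \sum_k A l k * y 0 k + h * A l k) j.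
  rewrite /F; congr (flow_limit _ _ _ _); apply/funext => l.
  rewrite -addrA; congr (_ + _).
  under eq_bigr => m _ do rewrite !mxE eqxx /= mulrDr.
  rewrite big_split /= addrC; congr (_ + _).
  rewrite (bigD1 k) //= eqxx mulr1 mulrC big1 ?addr0 // => m /negbTE mk.
  by rewrite mk mulr0 mulr0.
have := DH (fun l => b l + \sum_k A l k * y 0 k) j 0.
have -> : (fun i0 => b i0 + \sum_k0 A i0 k0 * y 0 k0 + 0 * A i0 k) =
  (fun l => b l + \sum_k A l k * y 0 k) by apply/funext => l; rewrite mul0r addr0.
rewrite -/dF => D; clearbody dF F.
apply/is_derive_lineP.
exact: eq_is_derive D.
Qed.

End Tangent.

(** * A scalar differential equation *)

Section ScalarODE.
Context {R : realType}.

Lemma antiderivative_segment (f : R -> R) (T : R) : 0 < T -> continuous f ->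
  exists2 F : R -> R, F 0 = 0 & forall t, `|t| < T -> is_derive t (1 : R) F (f t).
Proof.
move=> T0 cf.
pose F0 (x : R) := (\int[lebesgue_measure]_(s in [set` `[- T, x]]) f s)%R.
have D x : `|x| < T -> is_derive x (1 : R) F0 (f x).
  rewrite ltr_norml => /andP[Tx xT].
  have [||d <-] := @continuous_FTC1_closed R f (- T) x T xT _ Tx; last 1 first.
  - by rewrite derive1E; exact: derivableP.
  - apply: continuous_compact_integrable; first exact: segment_compact.
    exact: continuous_subspaceT.
  - exact: cf.
exists (fun x => F0 x - F0 0); first by rewrite subrr.
move=> t /D Dt; rewrite -[f t]subr0.
exact: (@is_deriveB _ _ _ F0 (cst (F0 0))).
Qed.

(** Antiderivatives on segments which vanish at 0 agree on the smaller segment. *)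
Lemma antiderivative (f : R -> R) : continuous f ->
  exists2 F : R -> R, F 0 = 0 & forall t, is_derive t (1 : R) F (f t).
Proof.
move=> cf; have H T : exists F : R -> R, 0 < T ->
    F 0 = 0 /\ forall t, `|t| < T -> is_derive t (1 : R) F (f t).
  have [T0|_] := ltP 0 T; last by exists (fun=> 0).
  by have [F F0 DF] := antiderivative_segment T0 cf; exists F.
have [F HF] := choice H.
have eqF S T t : S <= T -> `|t| < S -> F S t = F T t.
  move=> ST tS; have S0 : 0 < S by exact: le_lt_trans (normr_ge0 t) tS.
  have [F0 DF] := HF _ S0; have [F0' DF'] := HF _ (lt_le_trans S0 ST).
  apply/eqP; rewrite -subr_eq0 -normr_le0.
  have -> : F S t - F T t = (F S t - F T t) - (F S 0 - F T 0) by rewrite F0 F0' !subr0.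
  have := @mvt_bound _ (F S \- F T) (f \- f) 0 t 0; rewrite mul0r; apply => x xt.
  have xS : `|x| < S.
    move: tS xt; rewrite !ltr_norml => /andP[? ?].
    by case: (leP 0 t) => ? /andP[? ?]; lra.
  split; last by rewrite /= subrr normr0.
  by apply: is_deriveB; [exact: DF|apply: DF'; exact: lt_le_trans ST].
exists (fun t => F (`|t| + 1) t).
  by have [] := HF (`|0 : R| + 1) (ltr_wpDl (normr_ge0 _) ltr01).
move=> t; have t2 : 0 < `|t| + 2 by rewrite ltr_wpDl.
have [_ /(_ t) D] := HF _ t2.
have tt2 : `|t| < `|t| + 2 by lra.
apply: (near_eq_is_derive _ (D tt2)).
apply/nbhs_ballP; exists 1 => //= s; rewrite /ball /= => st.
symmetry; apply: (eqF (`|s| + 1) (`|t| + 2) s); last by lra.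
have := ler_normD (s - t) t; rewrite subrK distrC; lra.
Qed.

Definition clamp (r x : R) := Num.max (- r) (Num.min x r).

Lemma clamp_id r x : `|x| <= r -> clamp r x = x.
Proof.
by rewrite ler_norml /clamp => /andP[? ?]; rewrite (min_idPl _) // (max_idPr _).
Qed.

Lemma clamp_le r x : 0 <= r -> `|clamp r x| <= r.
Proof.
move=> r0; rewrite /clamp ler_norml.
by case: (leP x r) => ?; [case: (leP (- r) x)|case: (leP (- r) r)] => ?; lra.
Qed.

Lemma clamp_lipschitz r x y : 0 <= r -> `|clamp r x - clamp r y| <= `|x - y|.
Proof.
move=> r0; rewrite /clamp.
case: (leP x r) => ?; case: (leP y r) => ?;
  case: (leP (- r) x) => ?; case: (leP (- r) y) => ?; case: (leP (- r) r) => ?;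
  case: (ger0P (x - y)) => ?; rewrite ?ler_norml; lra.
Qed.

(** Picard iteration for g composed with the projection onto [- d / 2, d / 2],
    which is bounded and Lipschitz on the whole line; for |t| < T solutions do not
    leave that segment.  The time T depends on g through its bounds only: this
    uniformity provides flows from families of curves. *)
Lemma scalar_ode (d L : R) : 0 < d -> 0 < L -> exists2 T, 0 < T &
  forall g g' : R -> R,
    (forall s, `|s| < d -> [/\ is_derive s (1 : R) g (g' s), `|g s| <= L & `|g' s| <= L]) ->
  exists2 u : R -> R, u 0 = 0 &
    forall t, `|t| < T -> `|u t| < d /\ is_derive t (1 : R) u (g (u t)).
Proof.
move=> d0 L0; pose r := d / 2; have r0 : 0 <= r by rewrite /r; lra.
pose T := Num.min (r / L) (1 / (2 * L)).
have T0 : 0 < T by rewrite /T lt_min !divr_gt0 // ?mulr_gt0 // /r; lra.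
have LTr : L * T <= r by rewrite mulrC -ler_pdivlMr // /T ge_min lexx.
have LT2 : L * T <= 1 / 2.
  rewrite mulrC -ler_pdivlMr // (_ : 1 / 2 / L = 1 / (2 * L)); last by field; rewrite gt_eqF.
  by rewrite /T ge_min lexx orbT.
exists T => // g g' H.
pose G x := g (clamp r x).
have clampd x : `|clamp r x| < d by apply: le_lt_trans (clamp_le x r0) _; rewrite /r; lra.
have GL x : `|G x| <= L by have [] := H _ (clampd x).
have Glip x y : `|G x - G y| <= L * `|x - y|.
  apply: (@le_trans _ _ (L * `|clamp r x - clamp r y|)); last first.
    by rewrite ler_wpM2l ?clamp_lipschitz // ltW.
  apply: (@mvt_bound _ g g') => s.
  move: (clampd x) (clampd y); rewrite !ltr_norml => /andP[? ?] /andP[? ?] Hs.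
  have sd : `|s| < d.
    by move: Hs; rewrite ltr_norml; case: (leP (clamp r y) (clamp r x)) => ? /andP[? ?]; lra.
  by have [] := H _ sd.
have cG : continuous G.
  move=> x; apply/cvgrPdist_lt => e e0; apply/nbhs_ballP; exists (e / L) => /=.
    by rewrite divr_gt0.
  move=> y; rewrite /ball /= ltr_pdivlMr // mulrC; exact: le_lt_trans.
have A (u : R -> R) : exists F : R -> R, continuous u ->
    F 0 = 0 /\ forall t, is_derive t (1 : R) F (G (u t)).
  have [cu|nu] := pselect (continuous u); last by exists u.
  have [|F F0 DF] := @antiderivative (G \o u); last by exists F.
  by move=> x; apply: continuous_comp; [exact: cu|exact: cG].
have [P HP] := choice A.
pose u k := iter k P (fun=> 0).
have cu k : continuous (u k).
  elim: k => [|k IH] x; first exact: cst_continuous.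
  by have [_ D] := HP _ IH; exact: is_derive_continuous (D x).
have u0 k : u k 0 = 0.
  by case: k => [//|k]; have [] := HP _ (cu k).
have Du k t : is_derive t (1 : R) (u k.+1) (G (u k t)) by have [] := HP _ (cu k).
have segT t s : `|t| < T -> Num.min 0 t <= s <= Num.max 0 t -> `|s| < T.
  rewrite !ltr_norml => /andP[? ?].
  by case: (leP 0 t) => ? /andP[? ?]; lra.
have ub k t : `|t| < T -> `|u k.+1 t - u k t| <= L * T / 2 ^+ k.
  move=> tT; elim: k t tT => [|k IH] t tT.
    rewrite expr0 divr1; have -> : u 1%N t - u 0%N t = u 1%N t - u 1%N 0 by rewrite u0.
    apply: (@le_trans _ _ (L * `|t - 0|)); last by rewrite subr0 ler_pM2l // ltW.
    by apply: (@mvt_bound _ (u 1%N) (G \o u 0%N)) => s _; split; [exact: Du|exact: GL].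
  have -> : u k.+2 t - u k.+1 t = (u k.+2 t - u k.+1 t) - (u k.+2 0 - u k.+1 0).
    by rewrite !u0 !subr0.
  apply: (@le_trans _ _ (L * (L * T / 2 ^+ k) * `|t - 0|)).
    apply: (@mvt_bound _ (u k.+2 \- u k.+1) ((G \o u k.+1) \- (G \o u k))) => s /(segT _ _ tT) sT.
    split; first by apply: is_deriveB; exact: Du.
    by apply: le_trans (Glip _ _) _; rewrite ler_pM2l // IH.
  have p0 : 0 < 2 ^+ k :> R by rewrite exprn_gt0.
  have -> : L * T / 2 ^+ k.+1 = 1 / 2 * (L * T / 2 ^+ k) by rewrite exprS; field; rewrite gt_eqF.
  have -> : L * (L * T / 2 ^+ k) * `|t - 0| = (L * `|t|) * (L * T / 2 ^+ k) by rewrite subr0; ring.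
  rewrite ler_wpM2r //; first by rewrite divr_ge0 ?mulr_ge0 ?ltW.
  by apply: le_trans LT2; rewrite ler_pM2l // ltW.
pose v t := lim (u k t @[k --> \oo]).
have vb k t : `|t| < T -> `|u k t - v t| <= 2 * (L * T) / 2 ^+ k.
  by move=> tT; apply: (@geometric_limit _ (u ^~ t)) => {}k; exact: ub.
have Dv t : `|t| < T -> is_derive t (1 : R) v (G (v t)).
  move=> tT; apply: (@is_derive_unif_lim _ (fun k => u k.+1) (fun k s => G (u k s)) v
    (fun s => G (v s)) T) => // e e0.
  have L10 : 0 < L + 1 by lra.
  have [K HK] := half_pow_small (2 * (L * T)) (divr_gt0 e0 L10).
  exists K => k Kk x xT.
  have eL : e / (L + 1) <= e by rewrite ler_pdivrMr // ler_peMr ?ltW //; lra.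
  split.
    by apply: le_trans (vb k.+1 x xT) _; apply: le_trans (HK _ _) eL; rewrite ltnW.
  apply: le_trans (Glip _ _) _; apply: (@le_trans _ _ (L * (e / (L + 1)))).
    by rewrite ler_pM2l //; apply: le_trans (vb k x xT) _; exact: HK.
  by rewrite mulrA ler_pdivrMr // mulrC ler_pM2l //; lra.
have v0 : v 0 = 0.
  apply/eqP; rewrite -normr_le0; apply/ler_addgt0Pl => e e0.
  have [K HK] := half_pow_small (2 * (L * T)) e0.
  have T0' : `|0 : R| < T by rewrite normr0.
  have := vb K 0 T0'; rewrite u0 sub0r normrN => h.
  by rewrite addr0; apply: le_trans h (HK K _).
exists v => // t tT.
have vt : `|v t| <= r.
  have -> : v t = v t - v 0 by rewrite v0 subr0.
  apply: (@le_trans _ _ (L * `|t - 0|)).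
    by apply: (@mvt_bound _ v (G \o v)) => s /(segT _ _ tT) sT; split; [exact: Dv|exact: GL].
  by apply: le_trans LTr; rewrite subr0 ler_pM2l // ltW.
split; first by apply: le_lt_trans vt _; rewrite /r; lra.
by have := Dv t tT; rewrite /G clamp_id.
Qed.

End ScalarODE.

(** * Differential structures, derivations and charts *)

Section DifferentialSpace.
Context {R : realType} {S : topologicalType} {C : set (S -> R)}.
Hypothesis dsC : differential_structure C.
Implicit Types (f g h : S -> R) (x y : S) (W : set S).

(** The sub-basis axiom in terms of filters.  It is applied to the filter of sets
    that carry a bump, and to the image of a neighbourhood filter. *)
Lemma structure_nbhs (F : set_system S) x : Filter F ->
  (forall f a b, C f -> a < f x < b -> F (f @^-1` [set y | a < y < b])) -> F --> x.
Proof.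
move=> FF H; have [_ /(_ x) Bx] := ds_subbasis dsC.
move=> W /Bx [U [[D DB <-] Ux] UW]; apply: filterS UW _.
apply: filter_bigI => A AD; have /set_mem [f [a [b [Cf E]]]] := DB _ AD.
by have := Ux _ AD; rewrite /= E => fx; exact: H.
Qed.

Lemma structure_preimage_open f (a b : R) :
  C f -> open (f @^-1` [set y | a < y < b]).
Proof.
by move=> Cf; have [+ _] := ds_subbasis dsC; apply; apply: finI_from1; exists f, a, b.
Qed.

Lemma structure_continuous f : C f -> continuous f.
Proof.
move=> Cf x; apply/(@cvgrPdist_lt _ _ _ (nbhs x)) => e e0.
have := structure_preimage_open (f x - e) (f x + e) Cf.
rewrite openE => /(_ x) /=; rewrite ltrBlDr ltrDl e0 => /(_ isT).
by apply: filterS => y /= /andP[? ?]; rewrite ltr_norml; lra.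
Qed.

Lemma continuous_to_structure (T : topologicalType) (phi : T -> S) (t : T) :
  (forall f, C f -> {for t, continuous (f \o phi)}) -> {for t, continuous phi}.
Proof.
move=> H; apply: structure_nbhs => f a b Cf ab.
have := H f Cf; apply; apply: open_nbhs_nbhs; split => //.
have -> : [set y | a < y < b] = [set y | y > a] `&` [set y | y < b].
  by apply/seteqP; split=> y /= /andP.
by apply: openI; [exact: open_gt|exact: open_lt].
Qed.

Lemma structure_rV n (F : 'rV[R]_n -> R) (f : 'I_n -> S -> R) :
  smooth_rV F -> (forall i, C (f i)) -> C (fun x => F (\row_i f i x)).
Proof. by move=> sF Cf; exact: (ds_comp dsC). Qed.

Lemma structure_line (g : R -> R) f : smooth_line g -> C f -> C (g \o f).
Proof.
move=> sg Cf; pose F (v : 'rV[R]_1) := g (v 0 0).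
have -> : g \o f = fun x => F (\row_i (fun=> f) i x).
  by apply/funext => x; rewrite /F mxE.
by apply: structure_rV => //; apply: rV_expr_smooth; exact: rg_line.
Qed.

Lemma structure_cst c : C (cst c).
Proof.
apply: (@structure_rV 0 (fun=> c) (fun i => match i with Ordinal m H => cst 0 end)).
  by apply: rV_expr_smooth; exact: rg_cst.
by case.
Qed.

Lemma structure_mul f g : C f -> C g -> C (f \* g).
Proof.
move=> Cf Cg.
pose F (v : 'rV[R]_2) := v 0 0 * v 0 1.
have -> : f \* g = fun x => F (\row_i (fun i : 'I_2 => if i == 0 then f else g) i x).
  by apply/funext => x; rewrite /F !mxE.
apply: structure_rV => [|i]; last by case: ifP.
apply: rV_expr_smooth.
by apply: (rg_mul (F := fun v => v 0 0) (G := fun v => v 0 1)); exact: rg_coord.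
Qed.

Lemma structure_add f g : C f -> C g -> C (f \+ g).
Proof.
move=> Cf Cg.
pose F (v : 'rV[R]_2) := v 0 0 + v 0 1.
have -> : f \+ g = fun x => F (\row_i (fun i : 'I_2 => if i == 0 then f else g) i x).
  by apply/funext => x; rewrite /F !mxE.
apply: structure_rV => [|i]; last by case: ifP.
apply: rV_expr_smooth.
by apply: (rg_add (F := fun v => v 0 0) (G := fun v => v 0 1)); exact: rg_coord.
Qed.

Lemma structure_scale c f : C f -> C (fun x => c * f x).
Proof. by move=> Cf; exact: (structure_mul (structure_cst c) Cf). Qed.

Definition bump x W h := [/\ C h, \forall y \near x, h y = 1 &
  forall y, ~ W y -> \forall z \near y, h z = 0].

(** Sets with a bump form a filter, a product of bumps being a bump for the
    intersection; preimages of intervals have one, namely a plateau composed with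
    the function. *)
Lemma bump_exists x W : nbhs x W -> exists h, bump x W h.
Proof.
pose F : set_system S := [set W | exists h, bump x W h].
have FF : Filter F; first split.
- by exists (cst 1); split; [exact: structure_cst|exact: nearW|by move=> y []].
- move=> A B [f [Cf f1 f0]] [g [Cg g1 g0]]; exists (f \* g); split.
  + exact: structure_mul.
  + by near=> y; rewrite /= (near f1 y) // (near g1 y) // mulr1.
  + move=> y AB; have [Ay|nAy] := pselect (A y).
      have nBy : ~ B y by move=> By; exact: AB.
      by apply: filterS (g0 y nBy) => z /= ->; rewrite mulr0.
    by apply: filterS (f0 y nAy) => z /= ->; rewrite mul0r.
- by move=> A B AB [h [Ch h1 h0]]; exists h; split => // y nBy; apply: h0 => /AB.
have : F --> x; last exact.
apply: structure_nbhs => f a b Cf /andP[ax xb].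
pose r := Num.min (f x - a) (b - f x) / 3.
have r0 : 0 < r by rewrite divr_gt0 // lt_min !subr_gt0 ax.
have cf := structure_continuous Cf.
exists (plateau (f x) r \o f); split.
- exact/structure_line/Cf/plateau_smooth.
- have /cvgrPdist_lt /(_ _ r0) := cf x.
  by apply: filterS => y; rewrite distrC /= => /ltW; exact: plateau_eq1.
- move=> y ny; have /cvgrPdist_lt /(_ _ r0) := cf y.
  apply: filterS => z fz; apply: plateau_eq0 => //.
  have : 3 * r <= `|f y - f x|.
    have ra : 3 * r <= f x - a by rewrite /r mulrC divfK ?pnatr_eq0 // ge_min lexx.
    have rb : 3 * r <= b - f x by rewrite /r mulrC divfK ?pnatr_eq0 // ge_min lexx orbT.
    rewrite ler_normr; move: ny => /= /negP; rewrite negb_and -!leNgt.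
    by move=> /orP[h|h]; apply/orP; [right|left]; lra.
  by have := ler_distD (f z) (f y) (f x); lra.
Unshelve. all: by end_near. Qed.

Section Derivation.
Variable X : (S -> R) -> (S -> R).
Hypothesis dX : derivation C X.

Lemma derivation_zero f x : C f -> (forall y, f y = 0) -> X f x = 0.
Proof.
move=> Cf f0; have -> : f = fun x => 0 * f x by apply/funext => y; rewrite mul0r f0.
by rewrite (derivation_scale dX) // mul0r.
Qed.

(** For a bump h at x supported where f = g, the product h (f - g) vanishes
    identically, and the Leibniz rule at x gives X (f - g) x = 0. *)
Lemma derivation_local f g x : C f -> C g ->
  (\forall y \near x, f y = g y) -> X f x = X g x.
Proof.
move=> Cf Cg fg; have [h [Ch h1 h0]] := bump_exists fg.
pose k := f \+ (fun x => - 1 * g x).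
have Cg' : C (fun x => - 1 * g x) by exact: structure_scale.
have Ck : C k by exact: structure_add.
have kx : k x = 0 by rewrite /k /= (nbhs_singleton fg) mulN1r subrr.
have hx := nbhs_singleton h1.
have hk y : (h \* k) y = 0.
  have [/= E|ne] := pselect (f y = g y); first by rewrite /k /= E mulN1r subrr mulr0.
  by rewrite /= (nbhs_singleton (h0 y ne)) mul0r.
have := derivation_zero x (structure_mul Ch Ck) hk.
rewrite (derivation_leibniz dX) //= hx kx mul0r mul1r addr0.
rewrite (derivation_add dX) //= (derivation_scale dX) // mulN1r.
by move/eqP; rewrite subr_eq0 => /eqP.
Qed.

Lemma restrictionE f g x : C g -> (\forall y \near x, g y = f y) ->
  restriction C X f x = X g x.
Proof.
move=> Cg gf; rewrite /restriction; set P := [set g | _].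
have [Ch hf] : P (xget (cst 0) P) by apply: xgetPex; exists g.
apply: derivation_local => //; near=> y.
by rewrite (near hf y) // (near gf y).
Unshelve. all: by end_near. Qed.

End Derivation.

Lemma subspace_structure_open (U : set S) f x : open U -> U x ->
  subspace_structure C U f -> exists2 g, C g & \forall y \near x, f y = g y.
Proof.
move=> oU Ux /(_ x Ux) [V [g [oV Cg E]]]; exists g => //.
have nU : nbhs x U by exact: open_nbhs_nbhs.
have nV : nbhs x V by exact: open_nbhs_nbhs.
by near=> y; apply: E; [near: y|near: y].
Unshelve. all: by end_near. Qed.

Lemma subspace_structure_near (U : set S) f :
  (forall x, U x -> exists2 g, C g & \forall y \near x, f y = g y) ->
  subspace_structure C U f.
Proof.
move=> H x /H [g Cg gf].
have : nbhs x [set y | f y = g y] by exact: gf.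
rewrite nbhsE => -[V [oV Vx] VE].
by exists V, g; split => // y _ /VE.
Qed.

Lemma structure_near f :
  (forall x, exists2 g, C g & \forall y \near x, f y = g y) -> C f.
Proof.
move=> H; apply: (ds_local dsC) => x; have [g Cg gf] := H x.
have : nbhs x [set y | f y = g y] by exact: gf.
by rewrite nbhsE => -[V oV VE]; exists V, g.
Qed.

(** A local embedding of S into R^n by globally defined functions.  The functions F
    of the last clause are defined on R^n and smooth there, although the image of N
    may be any subset of R^n. *)
Definition chart (N : set S) (n : nat) (q : 'I_n -> S -> R) :=
  [/\ open N, forall i, C (q i),
    forall x y, N x -> N y -> (forall i, q i x = q i y) -> x = y &
    forall f x, C f -> N x -> exists F : 'rV[R]_n -> R, smooth_rV F /\
      exists2 r, 0 < r & forall y, N y -> (forall i, `|q i y - q i x| < r) ->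
        f y = F (\row_i q i y)].

End DifferentialSpace.

Section Chart.
Context {R : realType} {S : topologicalType} {C : set (S -> R)}.

(** The coordinates of the given chart are functions on its domain only; near x they
    agree with functions of the structure. *)
Lemma chart_exists x : subcartesian C -> exists N n (q : 'I_n -> S -> R), @chart R S C N n q /\ N x.
Proof.
move=> sc; 
have [U [n [A [phi [psi [[oU Ux] [[phiA cphi sphi] [psiU cpsi spsi] phiK psiK]]]]]]] :=
  sc_charts sc x.
have sc0 (F : 'rV[R]_n -> R) : smooth_rV F -> subspace_structure (@smooth_rV R n) A F.
  by move=> sF a Aa; exists setT, F; split => //; split => //; exact: openT.
have coord (i : 'I_n) : subspace_structure C U (fun y => phi y 0 i).
  by apply: (sphi (fun v => v 0 i)); apply: sc0; apply: rV_expr_smooth; exact: rg_coord.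
have H i : exists q, C q /\ \forall y \near x, phi y 0 i = q y.
  by have [q Cq E] := subspace_structure_open oU Ux (coord i); exists q.
have [q Hq] := choice H.
have : nbhs x [set y | U y /\ forall i, phi y 0 i = q i y].
  have nU : nbhs x U by exact: open_nbhs_nbhs.
  have : \forall y \near x, forall i, phi y 0 i = q i y.
    by apply: filter_forall => i; exact: (Hq i).2.
  exact: filterI.
rewrite nbhsE => -[N [oN Nx] NE].
have qphi y : N y -> phi y = \row_i q i y.
  by move=> /NE [_ E]; apply/rowP => i; rewrite mxE.
exists N, n, q; split=> //; split=> //.
- by move=> i; exact: (Hq i).1.
- move=> y z Ny Nz E; rewrite -(phiK y (NE y Ny).1) -(phiK z (NE z Nz).1) !qphi //.
  by congr (psi _); apply/rowP => i; rewrite !mxE.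
- move=> f y Cf Ny; have Uy := (NE y Ny).1.
  have fpsi : subspace_structure (@smooth_rV R n) A (f \o psi).
    apply: spsi => z Uz; exists setT, f; split => //; split => //; exact: openT.
  have [B [F [[oB By] sF E]]] := fpsi (phi y) (phiA y Uy).
  exists F; split=> //.
  have /nbhs_ballP [r /= r0 Hr] : nbhs (phi y) B by exact: open_nbhs_nbhs.
  exists r => // z Nz Hz; rewrite -qphi // -E.
  + by rewrite /= phiK //; exact: (NE z Nz).1.
  + by apply: phiA; exact: (NE z Nz).1.
  + apply: Hr; split=> // i j; rewrite ord1 /ball /= !qphi // !mxE distrC.
    exact: Hz.
Qed.

End Chart.

(** * Integral curves and the flow *)

Section IntegralCurves.
Context {R : realType} {S : topologicalType} {C : set (S -> R)}.
Hypothesis dsC : differential_structure C.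
Implicit Types (X : (S -> R) -> (S -> R)) (x : S) (c d : R -> S) (I J : set R).

(** On an open interval all derivatives are two-sided, and then continuity and
    smoothness of the curve follow from the differential equation. *)
Definition open_curve X (a : R) x c := c 0 = x /\
  forall t f, `|t| < a -> C f -> is_derive t (1 : R) (f \o c) (X f (c t)).

Lemma within_quotient_epsP (u : R -> R) I (t l : R) :
  ((s - t)^-1 * (u s - u t) @[s --> within I t^'] --> l) <->
  forall e, 0 < e -> exists2 r, 0 < r & forall s, I s -> `|s - t| < r ->
    `|u s - u t - l * (s - t)| <= e * `|s - t|.
Proof.
have E s : s != t ->
    `|l - (s - t)^-1 * (u s - u t)| * `|s - t| = `|u s - u t - l * (s - t)|.
  move=> st; rewrite -normrM distrC; congr (`|_|).
  by field; rewrite subr_eq0.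
split=> [/cvgrPdist_le H e /H|H].
  move=> [r /= r0 Hr]; exists r => // s Is sr.
  have [->|st] := eqVneq s t; first by rewrite !subrr mulr0 subr0 normr0 mulr0.
  by rewrite -E // ler_wpM2r //; apply: Hr => //=; rewrite distrC.
apply/cvgrPdist_le => e /H [r r0 Hr]; exists r => //= s ts st Is.
have sr : `|s - t| < r by rewrite distrC.
have st0 : 0 < `|s - t| by rewrite normr_gt0 subr_eq0.
by have := Hr s Is sr; rewrite -E // ler_pM2r.
Qed.

Lemma open_curve_continuous X a x c t : open_curve X a x c -> `|t| < a -> {for t, continuous c}.
Proof.
move=> [_ D] ta; apply: (continuous_to_structure dsC) => f Cf.
exact: is_derive_continuous (D t f ta Cf).
Qed.

Lemma is_interval_ball (a : R) : is_interval [set t : R | `|t| < a].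
Proof.
move=> s t /= sa ta u /andP[su ut]; move: sa ta; rewrite !ltr_norml; lra.
Qed.

(** Functions f o c cut off near t.  By the differential equation the derivative of
    f o c is (X f) o c, so they are closed under differentiation. *)
Inductive cut_gen c (t r : R) : (R -> R) -> Prop :=
| cut_base (g : R -> R) f : smooth_line g -> (forall s, r < `|s - t| -> g s = 0) -> C f ->
    cut_gen c t r (fun s => g s * f (c s))
| cut_add u v : cut_gen c t r u -> cut_gen c t r v -> cut_gen c t r (u \+ v).

Lemma cut_gen_smooth X a x c t r u : (forall f, C f -> C (X f)) ->
  open_curve X a x c -> (forall s, `|s - t| <= r -> `|s| < a) ->
  cut_gen c t r u -> smooth_line u.
Proof.
move=> CX [_ D] tra; apply: (smooth_line_coind (P := cut_gen c t r)) => {}u.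
elim=> {u} [g f sg g0 Cf|u v _ [u' gu Du] _ [v' gv Dv]]; last first.
  by exists (u' \+ v'); [exact: cut_add|move=> y; exact: is_deriveD].
exists ((fun s => g^`()%classic s * f (c s)) \+ (fun s => g s * X f (c s))).
  apply: cut_add; apply: cut_base => //; [exact: smooth_line_derive| |exact: CX].
  move=> s rs; rewrite derive1E (@near_eq_derive _ _ _ g (cst 0)) ?derive_cst //.
  apply/nbhs_ballP; exists (`|s - t| - r) => /=; first by rewrite subr_gt0.
  move=> y; rewrite /ball /= => sy; apply: g0.
  by have := ler_distD y s t; lra.
move=> s; have Dg := smooth_line_is_derive s sg.
have [sr|rs] := leP `|s - t| r.
  apply: (is_derive_eq (is_deriveM Dg (D s f (tra _ sr) Cf))); rewrite /GRing.scale /=; ring.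
have gs0 : \forall y \near s, g y = 0.
  apply/nbhs_ballP; exists (`|s - t| - r) => /=; first by rewrite subr_gt0.
  move=> y; rewrite /ball /= => sy; apply: g0.
  by have := ler_distD y s t; lra.
have g'0 : g^`()%classic s = 0.
  by rewrite derive1E (@near_eq_derive _ _ _ g (cst 0)) ?derive_cst.
rewrite /= g'0 (nbhs_singleton gs0) !mul0r addr0.
apply: (@near_eq_is_derive _ _ _ (cst 0)).
by apply: filterS gs0 => y ->; rewrite mul0r.
Qed.

Lemma open_curve_integral_curve X a x c : (forall f, C f -> C (X f)) -> 0 < a ->
  open_curve X a x c -> integral_curve C X x [set t | `|t| < a] c.
Proof.
move=> CX a0 oc; have [c0 D] := oc; split => //.
- exact: is_interval_ball.
- by rewrite /= normr0.
- split=> //.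
    apply/subspace_continuousP => t /= ta.
    by apply: cvg_within_filter; exact: open_curve_continuous oc ta.
  move=> f Cf' t /= ta.
  have Cf : C f.
    apply: structure_near => // y.
    by have [g Cg E] := @subspace_structure_open R S C setT f y openT Logic.I Cf'; exists g.
  pose r := (a - `|t|) / 3; have r0 : 0 < r by rewrite divr_gt0 // subr_gt0.
  exists [set s | `|s - t| < r], (fun s => plateau t r s * f (c s)); split.
  + split; last by rewrite /= subrr normr0.
    rewrite (_ : [set s | _] = ball t r); first exact: ball_open.
    by apply/seteqP; split => s; rewrite /ball /= distrC.
  + apply: (cut_gen_smooth (X := X) (a := a) (x := x) (c := c) (t := t) (r := 2 * r)) => //.
      move=> s sr; have := ler_normD (s - t) t; rewrite subrK.
      have : a = `|t| + 3 * r by rewrite /r mulrC divfK ?pnatr_eq0 //; ring.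
      lra.
    apply: cut_base => //; first exact: plateau_smooth.
    by move=> s rs; rewrite plateau_eq0 // ltW.
  + by move=> s _ /= sr; rewrite plateau_eq1 ?mul1r // ltW.
- move=> f t Cf /= ta; apply/(@within_quotient_epsP (f \o c)) => e e0.
  have /is_derive_epsP /(_ e e0) [r r0 Hr] := D t f ta Cf.
  by exists r => // s _; exact: Hr.
Qed.

(** Continuity, smoothness and the differential equation at t only involve the curve
    near t. *)
Lemma integral_curve_local X x I c : is_interval I -> I 0 -> c 0 = x ->
  (forall t, I t -> exists J d, [/\ integral_curve C X x J d, J t &
     exists2 r, 0 < r & forall s, I s -> `|s - t| < r -> J s /\ d s = c s]) ->
  integral_curve C X x I c.
Proof.
move=> iI I0 c0 H; split => //.
  split=> //.
    apply/subspace_continuousP => t It.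
    have [J [d [icd Jt [r r0 Hr]]]] := H t It.
    have [_ /subspace_continuousP /(_ t Jt) cd _] := ic_smooth icd.
    have [_ dt] := Hr t It ltac:(by rewrite subrr normr0).
    move=> V nV; have nV' : nbhs (d t) V by rewrite dt; exact: nV.
    have {nV'} nV' : \forall s \near t, J s -> V (d s) by exact: cd nV'.
    change (\forall s \near t, I s -> V (c s)).
    have nr : nbhs t [set s | `|s - t| < r].
      by apply/nbhs_ballP; exists r => //= s; rewrite /ball /= distrC.
    near=> s => Is; have [|Js <-] := Hr s Is; first by near: s.
    by apply: (near nV' s) => //; near: s.
  move=> f Cf t It; have [J [d [icd Jt [r r0 Hr]]]] := H t It.
  have [_ _ /(_ f Cf t Jt) [U [g [[oU Ut] sg E]]]] := ic_smooth icd.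
  exists (U `&` ball t r), g; split => //.
    by split; [apply: openI => //; exact: ball_open|split => //; exact: ballxx].
  move=> s Is [Us]; rewrite /ball /= distrC => sr.
  by have [Js <-] := Hr s Is sr; exact: E.
move=> f t Cf It; have [J [d [icd Jt [r r0 Hr]]]] := H t It.
have [_ dt] := Hr t It ltac:(by rewrite subrr normr0).
apply/(@within_quotient_epsP (f \o c)) => e e0.
have /(@within_quotient_epsP (f \o d)) /(_ e e0) [r' r'0 Hr'] := ic_deriv icd Cf Jt.
exists (Num.min r r'); first by rewrite lt_min r0.
move=> s Is; rewrite lt_min => /andP[sr sr'].
have [Js ds] := Hr s Is sr; have := Hr' s Js sr'.
by rewrite /= ds dt.
Unshelve. all: by end_near. Qed.

Definition extends (p q : set R * (R -> S)) :=
  p.1 `<=` q.1 /\ forall t, p.1 t -> q.2 t = p.2 t.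

Lemma extends_trans p q r : extends p q -> extends q r -> extends p r.
Proof.
move=> [pq pq'] [qr qr']; split; first exact: subset_trans pq qr.
by move=> t pt; rewrite qr' ?pq' //; exact: pq.
Qed.

(** Near each of its points t the union of the chain coincides with a single member:
    one that contains t together with points of the union on each side of t on
    which there are any. *)
Lemma chain_union X x (A : set (set R * (R -> S))) : A !=set0 ->
  (forall p, A p -> integral_curve C X x p.1 p.2) ->
  (forall p q, A p -> A q -> extends p q \/ extends q p) ->
  exists p, integral_curve C X x p.1 p.2 /\ forall q, A q -> extends q p.
Proof.
move=> [p0 Ap0] ic tot.
pose J := \bigcup_(p in A) p.1.
have H t : exists y, forall p, A p -> p.1 t -> p.2 t = y.
  have [[p Ap pt]|nJ] := pselect (J t); last first.
    by exists x => p Ap pt; case: nJ; exists p.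
  exists (p.2 t) => q Aq qt.
  by have [[_ E]|[_ E]] := tot p q Ap Aq; [exact: E|symmetry; exact: E].
have [d Hd] := choice H.
have big s t : J s -> J t -> exists p, [/\ A p, p.1 s & p.1 t].
  move=> [p Ap ps] [q Aq qt].
  by have [[pq _]|[qp _]] := tot p q Ap Aq; [exists q|exists p]; split => //; [exact: pq|exact: qp].
exists (J, d); split=> /=; last first.
  by move=> q Aq; split=> [t qt|t qt] /=; [exists q|symmetry; exact: Hd].
apply: integral_curve_local.
- move=> s t Js Jt u ut; have [p [Ap ps pt]] := big s t Js Jt.
  by exists p => //; exact: (ic_interval (ic p Ap) ps pt ut).
- by exists p0 => //; exact: ic_zero (ic p0 Ap0).
- by rewrite -(Hd 0 p0 Ap0 (ic_zero (ic p0 Ap0))); exact: ic_start (ic p0 Ap0).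
move=> t Jt.
have [t1 [r1 [Jt1 r10 t1t H1]]] : exists t1 r1, [/\ J t1, 0 < r1, t1 <= t &
    forall s, J s -> `|s - t| < r1 -> s < t -> t1 <= s].
  have [[s [Js st]]|ns] := pselect (exists s, J s /\ s < t).
    exists s, (t - s); split => //; [by rewrite subr_gt0|exact: ltW|].
    by move=> u _; rewrite ltr_norml; lra.
  by exists t, 1; split => // s Js _ st; case: ns; exists s.
have [t2 [r2 [Jt2 r20 t2t H2]]] : exists t2 r2, [/\ J t2, 0 < r2, t <= t2 &
    forall s, J s -> `|s - t| < r2 -> t < s -> s <= t2].
  have [[s [Js st]]|ns] := pselect (exists s, J s /\ t < s).
    exists s, (s - t); split => //; [by rewrite subr_gt0|exact: ltW|].
    by move=> u _; rewrite ltr_norml; lra.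
  by exists t, 1; split => // s Js _ st; case: ns; exists s.
have [p [Ap pt1 pt2]] := big t1 t2 Jt1 Jt2.
have inp s : t1 <= s <= t2 -> p.1 s by move=> s12; exact: (ic_interval (ic p Ap) pt1 pt2 s12).
exists p.1, p.2; split; [exact: ic|by apply: inp; rewrite t1t|].
exists (Num.min r1 r2); first by rewrite lt_min r10.
move=> s Js; rewrite lt_min => /andP[s1 s2].
suff ps : p.1 s by split => //; exact: Hd.
apply: inp; have [st|st|->] := ltgtP s t; last by rewrite t1t.
  by rewrite (H1 s Js s1 st) /=; lra.
by rewrite (H2 s Js s2 st) andbT; lra.
Qed.

(** Zorn's lemma, for the preorder of extension.  It is not antisymmetric, since the
    values of a curve outside its interval are irrelevant. *)
Lemma maximal_integral_curve_exists X x I c : integral_curve C X x I c ->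
  exists J d, [/\ maximal_integral_curve C X x J d, I `<=` J & forall t, I t -> d t = c t].
Proof.
move=> ic.
pose T := {p : set R * (R -> S) | integral_curve C X x p.1 p.2 /\ extends (I, c) p}.
have t0P : integral_curve C X x (I, c).1 (I, c).2 /\ extends (I, c) (I, c).
  by split => //; split.
pose t0 : T := exist _ (I, c) t0P.
have [||A tot|[[J d] [icJ [IJ Id]]] max] := @ZL_preorder T t0 (fun p q => `[< extends (sval p) (sval q) >]).
- by move=> p; apply/asboolP; split.
- by move=> p q r /asboolP pq /asboolP qr; apply/asboolP; exact: extends_trans pq qr.
- have [[p Ap]|nA] := pselect (A !=set0); last first.
    by exists t0 => s As; case: nA; exists s.
  have [|||q [icq Hq]] := @chain_union X x (sval @` A).
  + by exists (sval p), p.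
  + by move=> _ [[q [? ?]] _ <-].
  + move=> _ _ [q Aq <-] [r Ar <-].
    by have [/asboolP|/asboolP] := tot q r Aq Ar; [left|right].
  have qP : integral_curve C X x q.1 q.2 /\ extends (I, c) q.
    split => //; apply: (@extends_trans _ (sval p)); first by case: p {Ap} => p [].
    by apply: Hq; exists p.
  exists (exist _ q qP) => s As; apply/asboolP; apply: Hq; exists s => //.
exists J, d; split => //; split => // K e icK JK ed.
have KP : integral_curve C X x (K, e).1 (K, e).2 /\ extends (I, c) (K, e).
  split => //; apply: (@extends_trans _ (J, d)); first by split.
  by split.
have /asboolP [KJ _] : `[< extends (K, e) (J, d) >].
  by apply: (max (exist _ (K, e) KP)); apply/asboolP.
by apply/seteqP.
Qed.

Lemma open_curve_flow X a x c t : (forall f, C f -> C (X f)) -> open_curve X a x c ->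
  `|t| < a -> flow C X t x (c t).
Proof.
move=> CX oc ta; have a0 : 0 < a := le_lt_trans (normr_ge0 t) ta.
have [J [d [mx IJ Id]]] := maximal_integral_curve_exists (open_curve_integral_curve CX a0 oc).
by exists J, d; split => //; [exact: IJ|exact: Id].
Qed.

(** The curves through x for positive and for negative times have the same
    derivative at 0, hence fit together there. *)
Lemma flow_open_curve X a x y z : 0 < a -> flow C X a x y -> flow C X (- a) x z ->
  exists c, open_curve X a x c.
Proof.
move=> a0 [I1 [c1 [[ic1 _] Ia _]]] [I2 [c2 [[ic2 _] Ia' _]]].
have in1 s : 0 <= s <= a -> I1 s.
  by move=> sa; exact: (ic_interval ic1 (ic_zero ic1) Ia sa).
have in2 s : - a <= s <= 0 -> I2 s.
  by move=> sa; exact: (ic_interval ic2 Ia' (ic_zero ic2) sa).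
pose c t := if 0 <= t then c1 t else c2 t.
have c1E s : 0 <= s -> c s = c1 s by rewrite /c => ->.
have c2E s : s <= 0 -> c s = c2 s.
  rewrite /c le_eqVlt => /orP[/eqP ->|s0]; last by rewrite leNgt s0.
  by rewrite lexx (ic_start ic1) (ic_start ic2).
exists c; split; first by rewrite c1E // (ic_start ic1).
move=> t f ta Cf; apply/is_derive_epsP => e e0.
have P : 0 <= t -> exists2 r, 0 < r & forall s, 0 <= s -> `|s - t| < r ->
    `|f (c s) - f (c t) - X f (c t) * (s - t)| <= e * `|s - t|.
  move=> t0; have It : I1 t by apply: in1; move: ta; rewrite ltr_norml; lra.
  have /(@within_quotient_epsP (f \o c1)) /(_ e e0) [r r0 Hr] := ic_deriv ic1 Cf It.
  exists (Num.min r (a - t)); first by rewrite lt_min r0 subr_gt0 -(ger0_norm t0).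
  move=> s s0; rewrite lt_min => /andP[sr sa]; rewrite !c1E //; apply: Hr => //.
  by apply: in1; move: sa; rewrite ltr_norml; lra.
have N : t <= 0 -> exists2 r, 0 < r & forall s, s <= 0 -> `|s - t| < r ->
    `|f (c s) - f (c t) - X f (c t) * (s - t)| <= e * `|s - t|.
  move=> t0; have It : I2 t by apply: in2; move: ta; rewrite ltr_norml; lra.
  have /(@within_quotient_epsP (f \o c2)) /(_ e e0) [r r0 Hr] := ic_deriv ic2 Cf It.
  exists (Num.min r (a + t)).
    by rewrite lt_min r0; move: ta; rewrite ltr_norml; lra.
  move=> s s0; rewrite lt_min => /andP[sr sa]; rewrite !c2E //; apply: Hr => //.
  by apply: in2; move: sa; rewrite ltr_norml; lra.
have [t0|t0|t0] := ltgtP t 0.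
- have [r r0 Hr] := N (ltW t0); exists (Num.min r (- t)); first by rewrite lt_min r0 oppr_gt0.
  move=> s; rewrite lt_min => /andP[sr st]; apply: Hr => //.
  by move: st; rewrite ltr_norml; lra.
- have [r r0 Hr] := P (ltW t0); exists (Num.min r t); first by rewrite lt_min r0.
  move=> s; rewrite lt_min => /andP[sr st]; apply: Hr => //.
  by move: st; rewrite ltr_norml; lra.
- have [r r0 Hr] := P ltac:(by rewrite t0); have [r' r'0 Hr'] := N ltac:(by rewrite t0).
  exists (Num.min r r'); first by rewrite lt_min r0.
  move=> s; rewrite lt_min => /andP[sr sr'].
  by have [s0|/ltW s0] := leP 0 s; [exact: Hr|exact: Hr'].
Qed.

End IntegralCurves.

(** * Confinement of integral curves *)

Section Confinement.
Context {R : realType}.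

(** At the infimum m of the times at which the family is too far away, the mean value
    theorem still bounds the displacement by M m < r, and then it is less than r also
    shortly after m. *)
Lemma confine_real_ge0 (T : finType) (g dg : T -> R -> R) (a r M : R) : 0 < r -> 0 <= M ->
  (forall j t, 0 <= t < a -> is_derive t (1 : R) (g j) (dg j t)) ->
  (forall t, 0 <= t < a -> (forall j, `|g j t - g j 0| < r) -> forall j, `|dg j t| <= M) ->
  forall t, 0 <= t < a -> M * t < r -> forall j, `|g j t - g j 0| < r.
Proof.
move=> r0 M0 D B t /andP[t0 ta] Mt; apply: contrapT => nt.
pose good s := forall j, `|g j s - g j 0| < r.
pose A := [set s | 0 <= s <= t /\ ~ good s].
have At : A t by split => //; rewrite t0 lexx.
have iA : has_inf A by split; [exists t|exists 0 => s [/andP[]]].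
pose m := inf A.
have m0 : 0 <= m by apply: lb_le_inf; [exists t|move=> s [/andP[]]].
have mt : m <= t by apply: ge_inf => //; exact: iA.2.
have below s : 0 <= s -> s < m -> good s.
  move=> s0 sm; apply: contrapT => ns; have : m <= s; last by rewrite leNgt sm.
  by apply: ge_inf; [exact: iA.2|split => //; rewrite s0 /= (le_trans (ltW sm))].
have gm : good m.
  move=> j; have [m0'|mp] := ltP 0 m; last first.
    have -> : m = 0 by apply: le_anti; rewrite mp m0.
    by rewrite subrr normr0.
  have [||c cm E] := @MVT R (g j) (dg j) 0 m m0'.
  - by move=> x; rewrite in_itv /= => /andP[? ?]; apply: D; lra.
  - apply: derivable_within_continuous => x; rewrite in_itv /= => /andP[? ?].
    by have [] := D j x ltac:(lra).
  move: cm; rewrite in_itv /= => /andP[c0 cm].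
  rewrite E normrM subr0 (ger0_norm m0); apply: le_lt_trans Mt.
  apply: ler_pM => //; apply: B => [|j']; first by lra.
  by apply: below; [exact: ltW|].
have : \forall s \near m, forall j, `|g j s - g j 0| < r.
  apply: (@filter_forall R T (fun j s => `|g j s - g j 0| < r) (nbhs m)) => j; have e0 : 0 < r - `|g j m - g j 0| by rewrite subr_gt0.
  have cj := is_derive_continuous (D j m ltac:(lra)).
  move/cvgrPdist_lt: cj => /(_ _ e0); apply: filterS => s.
  by rewrite distrC; have := ler_distD (g j m) (g j s) (g j 0); lra.
move=> /nbhs_ballP [e /= e0 He].
have [s As se] := inf_adherent e0 iA.
have [/andP[s0 st] ns] := As; apply: ns; apply: He.
have ms : m <= s by apply: ge_inf => //; exact: iA.2.
by rewrite /ball /= distrC ger0_norm; rewrite -/m in se; lra.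
Qed.

Lemma confine_real (T : finType) (g dg : T -> R -> R) (a r M : R) : 0 < r -> 0 <= M ->
  (forall j t, `|t| < a -> is_derive t (1 : R) (g j) (dg j t)) ->
  (forall t, `|t| < a -> (forall j, `|g j t - g j 0| < r) -> forall j, `|dg j t| <= M) ->
  forall t, `|t| < a -> M * `|t| < r -> forall j, `|g j t - g j 0| < r.
Proof.
move=> r0 M0 D B t ta Mt; have [t0|t0] := leP 0 t.
  rewrite (ger0_norm t0) in ta Mt.
  apply: (@confine_real_ge0 T g dg a r M) => //; last by rewrite t0.
  - by move=> j s /andP[s0 sa]; apply: D; rewrite ger0_norm.
  - by move=> s /andP[s0 sa]; apply: B; rewrite ger0_norm.
rewrite (ltr0_norm t0) in ta Mt.
have := @confine_real_ge0 T (fun j s => g j (- s)) (fun j s => - dg j (- s)) a r M r0 M0 _ _ (- t).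
rewrite opprK oppr0; apply => //; last by rewrite ta oppr_ge0 ltW.
- move=> j s /andP[s0 sa]; rewrite -mulrN1.
  have Ds : is_derive (- s) (1 : R) (g j) (dg j (- s)).
    by apply: D; rewrite normrN ger0_norm.
  apply: (@is_derive_chain _ (fun s => - s) (g j)) => //.
- by move=> s /andP[s0 sa] H j; rewrite normrN; apply: B => //; rewrite normrN ger0_norm.
Qed.

Lemma finite_lower_bound (I : finType) (P : I -> R -> Prop) :
  (forall i r s, s <= r -> P i r -> P i s) -> (forall i, exists2 r, 0 < r & P i r) ->
  exists2 r, 0 < r <= 1 & forall i, P i r.
Proof.
move=> mono H; have H' i : exists r, 0 < r /\ P i r by have [r ? ?] := H i; exists r.
have [f Hf] := choice H'; exists (\big[Num.min/1]_i f i).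
  apply/andP; split; first by apply/bigmin_gtP; split=> // i _; have [] := Hf i.
  exact: bigmin_le_id.
by move=> i; apply: mono (Hf i).2; exact: bigmin_le_cond.
Qed.

(** The coordinates of a chart N determine X near x through functions on R^n, which
    are bounded on a small ball; but they do not prevent a curve from leaving N,
    for S need not be locally compact.  For this a bump b supported in the
    intersection of W and N is added to the coordinates: as long as b stays close to
    b x = 1, the curve is in W and in N, where X b and the derivatives of the
    coordinates are bounded. *)
Lemma confinement (S : topologicalType) (C : set (S -> R)) (X : (S -> R) -> (S -> R))
    (x : S) (W : set S) : subcartesian C -> derivation C X -> nbhs x W ->
  exists2 Q, open_nbhs x Q & Q `<=` W /\ exists2 d, 0 < d &
    forall y, Q y -> forall a c, @open_curve R S C X a y c ->
    forall t, `|t| < a -> `|t| < d -> W (c t).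
Proof.
move=> sc dX Wx; have dsC := sc_structure sc.
have [N [n [q [[oN Cq _ fac] Nx]]]] := chart_exists x sc.
have nWN : nbhs x (W `&` N).
  by apply: filterI => //; exact: open_nbhs_nbhs.
have [b [Cb b1 b0]] := bump_exists dsC nWN.
pose g (j : option 'I_n) := if j is Some i then q i else b.
have Cg j : C (g j) by case: j => [i|] //=; exact: Cq.
have bx := nbhs_singleton b1.
have [|j|M M0 HM] := @bounds_uniform R (option 'I_n) unit (fun j _ M => exists2 r, 0 < r &
    forall y, N y -> (forall i, `|q i y - q i x| < r) -> `|X (g j) y| <= M).
- by move=> j _ M M' MM' [r r0 H]; exists r => // y Ny yr; exact: le_trans (H y Ny yr) MM'.
- move=> _; have [F [sF [r r0 Hr]]] := fac (X (g j)) x (derivation_closed dX (Cg j)) Nx.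
  have /rV_continuousP /(_ 1 ltr01) [r' r'0 Hr'] :=
    smooth_rV_continuous sF (x := \row_i q i x).
  exists (`|F (\row_i q i x)| + 1), (Num.min r r'); first by rewrite lt_min r0.
  move=> y Ny yr; rewrite Hr => // [|i]; last first.
    by have := yr i; rewrite lt_min => /andP[].
  have := Hr' (\row_i q i y).
  have H i : `|(\row_i q i y) 0 i - (\row_i q i x) 0 i| < r'.
    by rewrite !mxE; have := yr i; rewrite lt_min => /andP[].
  move=> /(_ H) /ltW; have := ler_distD (F (\row_i q i x)) (F (\row_i q i y)) 0.
  by rewrite !subr0; lra.
have [|j|r /andP[r0 r1] Hr] := @finite_lower_bound (option 'I_n) (fun j r =>
    forall y, N y -> (forall i, `|q i y - q i x| < r) -> `|X (g j) y| <= M).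
- by move=> j r s sr H y Ny yr; apply: H => // i; exact: lt_le_trans (yr i) sr.
- by have [r r0 H] := HM j tt; exists r.
pose P := [set y | forall j, `|g j y - g j x| < r].
have PWN y : P y -> (W `&` N) y.
  move=> /(_ None) /=; rewrite bx => by1; apply: contrapT => /b0 /nbhs_singleton by0.
  by move: by1; rewrite by0 sub0r normrN normr1; lra.
have PM y : P y -> forall j, `|X (g j) y| <= M.
  by move=> Py j; apply: Hr => [|i]; [have [] := PWN y Py|exact: (Py (Some i))].
have r2 : 0 < r / 2 by lra.
have : nbhs x [set y | forall j, `|g j y - g j x| < r / 2].
  apply: filter_forall => j; have := structure_continuous dsC (Cg j) (x := x).
  by move/cvgrPdist_lt => /(_ _ r2); apply: filterS => y; rewrite distrC.
rewrite nbhsE => -[Q [oQ Qx] HQ]; exists Q => //.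
have halves y z : (forall j, `|g j y - g j x| < r / 2) ->
    (forall j, `|g j z - g j y| < r / 2) -> P z.
  move=> xy yz j; have := xy j; have := yz j.
  by have := ler_distD (g j y) (g j z) (g j x); lra.
split.
  move=> y /HQ Hy; have [] // := PWN y.
  by apply: halves Hy _ => j; rewrite subrr normr0.
have M1 : 0 < M + 1 by lra.
exists (r / 2 / (M + 1)); first by rewrite divr_gt0.
move=> y /HQ Hy a c [c0 D] t ta td.
have [] // := PWN (c t); apply: (halves y _ Hy).
have := @confine_real (option 'I_n) (fun j t => g j (c t)) (fun j t => X (g j) (c t)) a (r / 2) M r2 M0.
rewrite c0; apply => //.
- by move=> j s sa; apply: D.
- by move=> s sa H; apply: PM; exact: halves Hy H.
- move: td; rewrite ltr_pdivlMr // mulrC; apply: le_lt_trans.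
  by rewrite ler_wpM2r //; lra.
Qed.

End Confinement.

(** * A criterion for vector fields *)

Section FieldExtension.
Context {R : realType} {S : topologicalType} {C : set (S -> R)}.

Lemma smooth_rV_prod n (s : seq 'I_n) (F : 'I_n -> 'rV[R]_n -> R) :
  (forall j, smooth_rV (F j)) -> smooth_rV (fun v => \prod_(j <- s) F j v).
Proof.
move=> sF; apply: rV_expr_smooth; elim: s => [|j s IH].
  by under eq_fun => v do rewrite big_nil; exact: rg_cst.
under eq_fun => v do rewrite big_cons.
by apply: (rg_mul (F := F j)) => //; exact: rg_base.
Qed.

(** The functions Z (q i) factor through the coordinates near x.  Multiplying by a
    plateau makes the factors compactly supported without changing them near the
    image of x. *)
Lemma field_extension (Z : (S -> R) -> S -> R) (x : S) (N : set S) (n : nat)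
    (q : 'I_n -> S -> R) :
  derivation C Z -> @chart R S C N n q -> N x ->
  exists2 G : 'I_n -> ('I_n -> R) -> R, (forall i, tame (G i)) &
  exists2 r, 0 < r & forall y, N y -> (forall j, `|q j y - q j x| < r) ->
    forall i, Z (q i) y = G i (q^~ y).
Proof.
move=> dZ [oN Cq _ fac] Nx.
have H i : exists F : 'rV[R]_n -> R, smooth_rV F /\ exists2 r, 0 < r &
    forall y, N y -> (forall j, `|q j y - q j x| < r) -> Z (q i) y = F (\row_j q j y).
  exact: fac (derivation_closed dZ (Cq i)) Nx.
have [F HF] := choice H.
have [|i|r /andP[r0 r1] Hr] := @finite_lower_bound R 'I_n (fun i r => forall y, N y ->
    (forall j, `|q j y - q j x| < r) -> Z (q i) y = F i (\row_j q j y)).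
- by move=> j r s sr E y Ny yr; apply: E => // i; exact: lt_le_trans (yr i) sr.
- exact: (HF i).2.
pose chi (v : 'rV[R]_n) := \prod_j plateau (q j x) r (v 0 j).
pose K i (v : 'rV[R]_n) := chi v * F i v.
have schi : smooth_rV chi.
  apply: (@smooth_rV_prod n (index_enum 'I_n) (fun j v => plateau (q j x) r (v 0 j))) => j.
  by apply/rV_expr_smooth/rg_line; exact: plateau_smooth.
pose B := \sum_j `|q j x| + 2 * r.
have S0 : 0 <= \sum_j `|q j x| by apply: sumr_ge0.
exists (fun i a => K i (\row_j a j)) => [i|].
  apply: (@tame_of_compact _ _ B); first by rewrite /B; lra.
    apply: rV_expr_smooth; apply: (rg_mul (F := chi)); apply: rg_base => //.
    exact: (HF i).1.
  move=> v j Bv; rewrite /K /chi (bigD1 j) //= plateau_eq0 ?mul0r //.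
  have : `|q j x| <= \sum_j `|q j x| by rewrite (bigD1 j) //= lerDl sumr_ge0.
  have := ler_normD (v 0 j - q j x) (q j x); rewrite subrK.
  by move: Bv; rewrite /B; lra.
exists r => // y Ny yr i; rewrite (Hr i y Ny yr) /K /chi big1 ?mul1r // => j _.
by rewrite mxE plateau_eq1 // ltW.
Qed.

End FieldExtension.

Section VectorFieldCriterion.
Context {R : realType} {S : topologicalType} {C : set (S -> R)}.
Hypothesis sc : subcartesian C.
Variable Z : (S -> R) -> S -> R.
Hypothesis dZ : derivation C Z.

Let dsC : differential_structure C := sc_structure sc.

Section LocalFlow.
Variables (N : set S) (n : nat) (q : 'I_n -> S -> R) (G : 'I_n -> ('I_n -> R) -> R).
Variables (A : set S) (d : R) (fl : S -> R -> S).
Hypothesis cN : @chart R S C N n q.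
Hypothesis nG : forall i, tame (G i).
Hypothesis oA : open A.
Hypothesis AN : A `<=` N.
Hypothesis curve : forall y, A y -> open_curve (C := C) Z d y (fl y).
Hypothesis stay : forall y t, A y -> `|t| < d -> N (fl y t).
Hypothesis ZG : forall y t i, A y -> `|t| < d -> Z (q i) (fl y t) = G i (q^~ (fl y t)).

(** In coordinates the curves solve y' = G y, hence are given by the smooth map
    [flow_limit G]; their starting time may be any s. *)
Lemma local_flow_limit y s t i : A y -> `|s| < d -> `|t| < d ->
  q i (fl y t) = flow_limit G (t - s) (q^~ (fl y s)) i.
Proof.
move=> Ay sd td; have [M [L [M0 L0 GM GL]]] := tame_field_bounds nG.
have [_ Cq _ _] := cN.
have := @flow_limit_solution R 'I_n G M L M0 L0 GM GL (fun u j => q j (fl y u)) s (t - s).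
rewrite addrC subrK => E; apply: E => u su j; rewrite -ZG //; last first.
  move: sd td su; rewrite !ltr_norml => /andP[? ?] /andP[? ?].
  by case: (leP s t) => ? /andP[? ?]; lra.
have [_ D] := curve Ay; apply: D => //.
move: sd td su; rewrite !ltr_norml => /andP[? ?] /andP[? ?].
by case: (leP s t) => ? /andP[? ?]; lra.
Qed.

Lemma local_flow_start y : A y -> fl y 0 = y.
Proof. by move=> /curve []. Qed.

(** Near the image point f is F o q with F smooth on R^n, and q o fl_t is the smooth
    map [flow_limit G t] composed with q. *)
Lemma local_flow_pullback y t f : A y -> `|t| < d -> C f ->
  exists2 g, C g & \forall z \near y, f (fl z t) = g z.
Proof.
move=> Ay td Cf; have [oN Cq _ fac] := cN.
have d0 : `|0 : R| < d by rewrite normr0; exact: le_lt_trans td.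
have [F [sF [r r0 Hr]]] := fac f (fl y t) Cf (stay Ay td).
pose P i z := flow_limit G t (q^~ z) i.
have CP i : C (P i).
  have := structure_rV dsC (flow_limit_smooth t i nG) Cq.
  rewrite (_ : (fun z => _) = P i) //; apply/funext => z; congr (flow_limit _ _ _ _).
  by apply/funext => j; rewrite mxE.
have PE z i : A z -> q i (fl z t) = P i z.
  by move=> Az; rewrite (local_flow_limit i Az d0 td) subr0 local_flow_start.
exists (fun z => F (\row_i P i z)); first exact: (structure_rV dsC sF CP).
have nA : \forall z \near y, A z by apply: open_nbhs_nbhs.
have nP : \forall z \near y, forall i, `|P i z - P i y| < r.
  apply: filter_forall => i; have := structure_continuous dsC (CP i) (x := y).
  by move/cvgrPdist_lt => /(_ _ r0); apply: filterS => z; rewrite distrC.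
near=> z; have Az : A z by near: z.
rewrite (Hr (fl z t)); first by congr F; apply/rowP => i; rewrite !mxE PE.
  exact: stay.
by move=> i; rewrite !PE //; move: i; near: z.
Unshelve. all: by end_near. Qed.

Lemma local_flow_continuous y t : A y -> `|t| < d -> {for y, continuous (fl^~ t)}.
Proof.
move=> Ay td; apply: (continuous_to_structure dsC) => f Cf.
have [g Cg fg] := local_flow_pullback Ay td Cf.
have cg : g z @[z --> y] --> f (fl y t).
  by rewrite (nbhs_singleton fg); exact: structure_continuous dsC _ Cg y.
apply: cvg_trans cg; apply: near_eq_cvg.
by apply: filterS fg => z /= ->.
Qed.

Lemma local_flow_smooth (U V : set S) t : open U -> U `<=` A -> open V -> `|t| < d ->
  (forall y, U y -> V (fl y t)) -> smooth_map C U C V (fl^~ t).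
Proof.
move=> oU UA oV td UV; split=> //.
  apply/subspace_continuousP => y Uy; apply: cvg_within_filter.
  exact: local_flow_continuous (UA y Uy) td.
move=> f Cf; apply: subspace_structure_near => y Uy.
have [g Cg fg] := subspace_structure_open oV (UV y Uy) Cf.
have [g' Cg' gg'] := local_flow_pullback (UA y Uy) td Cg.
exists g' => //.
have fg' : \forall z \near y, f (fl z t) = g (fl z t).
  exact: (local_flow_continuous (UA y Uy) td) fg.
by near=> z; rewrite /= (near fg' z) // (near gg' z).
Unshelve. all: by end_near. Qed.

(** Both points have the same coordinates: running the curve back from time t to
    time 0 leads to y. *)
Lemma local_flow_inverse y t : A y -> `|t| < d -> A (fl y t) -> fl (fl y t) (- t) = y.
Proof.
move=> Ay td Ayt; have [_ _ inj _] := cN.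
have d0 : `|0 : R| < d by rewrite normr0; exact: le_lt_trans td.
apply: inj; [by apply: stay; rewrite ?normrN|exact: AN|move=> i].
rewrite (local_flow_limit i Ayt d0) ?normrN // subr0 local_flow_start //.
by rewrite -[y in RHS]local_flow_start // (local_flow_limit i Ay td d0) sub0r.
Qed.

End LocalFlow.

(** Confinement is applied twice, to get x in B, B inside A, such that curves from B
    stay in A and curves from A stay in the chart.  The time t map is smooth on A
    and maps B onto the set of points z of A whose image under the time - t map
    is in B, which is open. *)
Lemma vector_field_criterion :
  (forall x, exists Q e, [/\ open_nbhs x Q, 0 < e &
     forall y, Q y -> exists c, open_curve (C := C) Z e y c]) -> vector_field C Z.
Proof.
move=> H; split => // x.
have [Q [e [[oQ Qx] e0 HQ]]] := H x.
have [N [n [q [cN Nx]]]] := chart_exists x sc.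
have [oN Cq _ _] := cN.
have [G nG [r r0 ZG]] := field_extension dZ cN Nx.
pose N1 := [set y | [/\ N y, Q y & forall j, `|q j y - q j x| < r]].
have nN1 : nbhs x N1.
  have nN : \forall y \near x, N y by exact: open_nbhs_nbhs.
  have nQ : \forall y \near x, Q y by exact: open_nbhs_nbhs.
  have nq : \forall y \near x, forall j, `|q j y - q j x| < r.
    apply: filter_forall => j; have := structure_continuous dsC (Cq j) (x := x).
    by move/cvgrPdist_lt => /(_ _ r0); apply: filterS => y; rewrite distrC.
  by near=> y; split; near: y.
have [A [oA Ax] [AN1 [d1 d10 stayA]]] := confinement sc dZ nN1.
have nA : nbhs x A by exact: open_nbhs_nbhs.
have [B [oB Bx] [BA [d2 d20 stayB]]] := confinement sc dZ nA.
have AQ y : A y -> Q y by move=> /AN1 [].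
have fl_ex y : exists c, A y -> open_curve (C := C) Z e y c.
  have [/AQ /HQ [c Hc]|nAy] := pselect (A y); first by exists c.
  by exists (fun=> y).
have [fl Hfl] := choice fl_ex.
pose d := Num.min e (Num.min d1 d2).
have d0 : 0 < d by rewrite !lt_min e0 d10.
have dle (t : R) : `|t| < d -> [/\ `|t| < e, `|t| < d1 & `|t| < d2].
  by rewrite !lt_min => /and3P[].
have curve y : A y -> open_curve (C := C) Z d y (fl y).
  move=> Ay; have [f0 D] := Hfl y Ay; split => // t f td Cf.
  by apply: D => //; have [] := dle t td.
have stay1 y t : A y -> `|t| < d -> N1 (fl y t).
  move=> Ay td; have [te t1 _] := dle t td.
  exact: stayA Ay e (fl y) (Hfl y Ay) t te t1.
have stay y t : A y -> `|t| < d -> N (fl y t) by move=> Ay td; have [] := stay1 y t Ay td.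
have ZGA y t i : A y -> `|t| < d -> Z (q i) (fl y t) = G i (q^~ (fl y t)).
  by move=> Ay td; have [Ny _ yr] := stay1 y t Ay td; exact: ZG.
have stayBA y t : B y -> `|t| < d -> A (fl y t).
  move=> By td; have [te _ t2] := dle t td.
  exact: stayB By e (fl y) (Hfl y (BA y By)) t te t2.
have AN : A `<=` N by move=> y /AN1 [].
have inv y t := @local_flow_inverse N n q G A d fl cN nG AN curve stay ZGA y t.
have smo U V t := @local_flow_smooth N n q G A d fl cN nG oA curve stay ZGA U V t.
have cont y t := @local_flow_continuous N n q G A d fl cN nG oA curve stay ZGA y t.
exists B, d; split => // t td'.
have td : `|t| < d by rewrite ltr_norml.
have tdN : `|- t| < d by rewrite normrN.
pose V := [set z | A z /\ B (fl z (- t))].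
have oV : open V.
  rewrite openE => z [Az Bz].
  have nAz : \forall y \near z, A y by exact: open_nbhs_nbhs.
  have nBz : \forall y \near z, B (fl y (- t)).
    by apply: (cont z (- t) Az tdN); exact: open_nbhs_nbhs.
  by rewrite /interior /=; near=> y; split; near: y.
have BV y : B y -> V (fl y t).
  move=> By; have Ay := stayBA y t By td; split => //.
  by rewrite inv //; exact: BA.
exists V, (fl^~ t), (fl^~ (- t)); split => //.
  split.
  - exact: smo.
  - by apply: smo => // z [].
  - by move=> y By; apply: inv => //; [exact: BA|exact: stayBA].
  - by move=> z [Az Bz]; have := inv z (- t) Az tdN (BA _ Bz); rewrite opprK.
move=> y By; apply: (open_curve_flow dsC) (Hfl y (BA y By)) _; last by have [] := dle t td.
by move=> f Cf; exact: (derivation_closed dZ Cf).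
Unshelve. all: by end_near. Qed.

End VectorFieldCriterion.

(** * Push-forward, cut-off and the theorem *)

Section Reparametrization.
Context {R : realType} {S : topologicalType} {C : set (S -> R)}.

(** If c is an integral curve of Y and u' = H (c u), then c o u is an integral curve
    of H Y.  Confinement bounds H and Y H along c, and so the time for which u
    exists, independently of the curve. *)
Lemma reparametrized_curves (Y : (S -> R) -> S -> R) (H : S -> R) (x : S) (W : set S) :
  subcartesian C -> vector_field C Y -> C H -> nbhs x W ->
  exists Q e, [/\ nbhs x Q, 0 < e & forall y, Q y -> exists2 c,
    open_curve (C := C) (fun f z => H z * Y f z) e y c & forall t, `|t| < e -> W (c t)].
Proof.
move=> sc [dY vY] CH Wx; have dsC := sc_structure sc.
have [U [e [[oU Ux] e0 He]]] := vY x.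
have curves y : U y -> exists c, open_curve (C := C) Y (e / 2) y c.
  move=> Uy; have [|V1 [f1 [g1 [_ _ _ /(_ y Uy) F1]]]] := He (e / 2); first by lra.
  have [|V2 [f2 [g2 [_ _ _ /(_ y Uy) F2]]]] := He (- (e / 2)); first by lra.
  by apply: flow_open_curve F1 F2; lra.
pose L := `|H x| + `|Y H x| + 1.
have L0 : 0 < L by rewrite /L; have := normr_ge0 (H x); have := normr_ge0 (Y H x); lra.
have bnd f : C f -> `|f x| < L -> \forall z \near x, `|f z| < L.
  move=> Cf fL; have e1 : 0 < L - `|f x| by rewrite subr_gt0.
  have /cvgrPdist_lt /(_ _ e1) := structure_continuous dsC Cf (x := x).
  by apply: filterS => z; have := ler_distD (f x) (f z) 0; rewrite !subr0 distrC; lra.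
have nW : nbhs x [set z | [/\ W z, `|H z| < L & `|Y H z| < L]].
  have nH : \forall z \near x, `|H z| < L.
    by apply: bnd => //; rewrite /L; have := normr_ge0 (Y H x); lra.
  have nYH : \forall z \near x, `|Y H z| < L.
    apply: bnd; first exact: (derivation_closed dY).
    by rewrite /L; have := normr_ge0 (H x); lra.
  by near=> z; split; near: z.
have [A [oA Ax] [_ [d d0 stay]]] := confinement sc dY nW.
have m0 : 0 < Num.min (e / 2) d by rewrite lt_min d0 andbT; lra.
have [T T0 HT] := scalar_ode m0 L0.
exists (A `&` U), T; split=> //.
  by apply: filterI; apply: open_nbhs_nbhs.
move=> y [Ay Uy]; have [c oc] := curves y Uy; have [c0 D] := oc.
have inW t : `|t| < Num.min (e / 2) d -> [/\ W (c t), `|H (c t)| < L & `|Y H (c t)| < L].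
  by rewrite lt_min => /andP[te td]; exact: stay Ay _ _ oc t te td.
have [|u u0 Hu] := HT (H \o c) (Y H \o c).
  move=> s sm; have [_ /ltW ? /ltW ?] := inW s sm; split => //.
  by apply: D => //; move: sm; rewrite lt_min => /andP[].
exists (c \o u); last by move=> t /Hu [ut _]; have [] := inW (u t) ut.
split; first by rewrite /= u0.
move=> t f /Hu [ut Du] Cf; rewrite /= mulrC.
apply: (@is_derive_chain _ u (f \o c)) => //.
by apply: D => //; move: ut; rewrite lt_min => /andP[].
Unshelve. all: by end_near. Qed.

End Reparametrization.

Section PushForward.
Context {R : realType} {S : topologicalType} {C : set (S -> R)}.
Hypothesis sc : subcartesian C.
Variables (Y : (S -> R) -> S -> R) (U V : set S) (phi psi : S -> S).
Hypothesis vY : vector_field C Y.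
Hypothesis oU : open U.
Hypothesis oV : open V.
Hypothesis dphi : diffeomorphism C U C V phi psi.

Let dsC : differential_structure C := sc_structure sc.
Let dY : derivation C Y := vY.1.

Let psiU y : V y -> U (psi y). Proof. by case: dphi => _ [+ _ _] _ _; exact. Qed.
Let phiK y : U y -> psi (phi y) = y. Proof. by case: dphi => _ _ + _; exact. Qed.
Let psiK y : V y -> phi (psi y) = y. Proof. by case: dphi => _ _ _; exact. Qed.

Let psi_continuous y : V y -> {for y, continuous psi}.
Proof.
case: dphi => _ [_ + _] _ _ Vy; rewrite continuous_open_subspace //; apply.
exact: mem_set.
Qed.

Let phi_continuous y : U y -> {for y, continuous phi}.
Proof.
case: dphi => [[_ + _] _ _ _] Uy; rewrite continuous_open_subspace //; apply.
exact: mem_set.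
Qed.

Let subspaceC (A : set S) f : C f -> subspace_structure C A f.
Proof. by move=> Cf; apply: subspace_structure_near => y _; exists f => //; exact: nearW. Qed.

Lemma pullback_local f y : subspace_structure C V f -> U y ->
  exists2 g, C g & \forall z \near y, g z = f (phi z).
Proof.
move=> Cf Uy; have [[_ _ H] _ _ _] := dphi.
have [g Cg E] := subspace_structure_open oU Uy (H f Cf); exists g => //.
by apply: filterS E => z /= ->.
Qed.

(** For h supported in V this is h times the push-forward, extended by 0: outside V
    the second factor has an irrelevant value, which is multiplied by 0. *)
Definition cut_pushforward (h : S -> R) f y := h y * Defs.pushforward C phi psi Y f y.

Lemma pushforwardE f g y : C g -> (\forall z \near psi y, g z = f (phi z)) ->
  Defs.pushforward C phi psi Y f y = Y g (psi y).
Proof. by move=> Cg E; exact: (restrictionE dsC dY Cg E). Qed.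

(** The push-forward is only evaluated on functions on V; like every derivation it
    is local. *)
Lemma pushforward_local f g y : V y -> subspace_structure C V f ->
  (\forall z \near y, f z = g z) ->
  Defs.pushforward C phi psi Y f y = Defs.pushforward C phi psi Y g y.
Proof.
move=> Vy Cf fg; have [k Ck E] := pullback_local Cf (psiU Vy).
rewrite (pushforwardE Ck E) (pushforwardE (f := g) Ck) //.
have fg' : \forall z \near psi y, f (phi z) = g (phi z).
  have n : nbhs (phi (psi y)) [set w | f w = g w] by rewrite psiK.
  exact: (phi_continuous (psiU Vy) n).
by near=> z; rewrite (near E z) // (near fg' z).
Unshelve. all: by end_near. Qed.

Lemma pushforward_structure f y : C f -> V y ->
  exists2 g, C g & \forall z \near y, Defs.pushforward C phi psi Y f z = g z.
Proof.
move=> Cf Vy; have Uy := psiU Vy.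
have [g Cg E] := pullback_local (subspaceC (A := V) Cf) Uy.
have [_ [_ _ Hpsi] _ _] := dphi.
have [k Ck Ek] := subspace_structure_open oV Vy
  (Hpsi _ (subspaceC (A := U) (derivation_closed dY Cg))).
exists k => //.
have E' : \forall z \near y, \forall w \near psi z, g w = f (phi w).
  exact: (psi_continuous Vy (near_join E)).
near=> z; rewrite -(near Ek z) //= (pushforwardE Cg) //; near: z; exact: E'.
Unshelve. all: by end_near. Qed.

Section CutOff.
Variables (x : S) (h : S -> R).
Hypothesis bh : bump (C := C) x V h.

Let Ch : C h. Proof. by case: bh. Qed.
Let h0 y : ~ V y -> \forall z \near y, h z = 0. Proof. by case: bh => _ _; exact. Qed.

Lemma cut_pushforward_off f y : ~ V y -> cut_pushforward h f y = 0.
Proof. by move=> /h0 /nbhs_singleton hy; rewrite /cut_pushforward hy mul0r. Qed.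

Lemma cut_pushforward_derivation : derivation C (cut_pushforward h).
Proof.
have pull f y : C f -> V y -> exists2 g, C g & \forall z \near psi y, g z = f (phi z).
  by move=> Cf Vy; exact: (pullback_local (subspaceC Cf) (psiU Vy)).
split.
- move=> f Cf; apply: (structure_near dsC) => y.
  have [Vy|nVy] := pselect (V y).
    have [g Cg E] := pushforward_structure Cf Vy; exists (h \* g).
      exact: structure_mul.
    by apply: filterS E => z /= <-.
  exists (cst 0); first exact: structure_cst.
  by apply: filterS (h0 nVy) => z; rewrite /cut_pushforward => ->; rewrite mul0r.
- move=> f g Cf Cg; apply/funext => y /=.
  have [Vy|nVy] := pselect (V y); last by rewrite !cut_pushforward_off ?addr0.
  have [f' Cf' Ef] := pull f y Cf Vy; have [g' Cg' Eg] := pull g y Cg Vy.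
  rewrite /cut_pushforward (pushforwardE Cf' Ef) (pushforwardE Cg' Eg).
  rewrite (pushforwardE (g := f' \+ g')); [|exact: structure_add|].
    by rewrite (derivation_add dY) //= mulrDr.
  by near=> z; rewrite /= (near Ef z) // (near Eg z).
- move=> a f Cf; apply/funext => y.
  have [Vy|nVy] := pselect (V y); last by rewrite !cut_pushforward_off ?mulr0.
  have [f' Cf' Ef] := pull f y Cf Vy.
  rewrite /cut_pushforward (pushforwardE Cf' Ef).
  rewrite (pushforwardE (g := fun z => a * f' z)); [|exact: structure_scale|].
    by rewrite (derivation_scale dY) // mulrCA.
  by near=> z; rewrite (near Ef z).
- move=> f g Cf Cg; apply/funext => y /=.
  have [Vy|nVy] := pselect (V y); last by rewrite !cut_pushforward_off ?mulr0 ?addr0.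
  have [f' Cf' Ef] := pull f y Cf Vy; have [g' Cg' Eg] := pull g y Cg Vy.
  rewrite /cut_pushforward (pushforwardE Cf' Ef) (pushforwardE Cg' Eg).
  rewrite (pushforwardE (g := f' \* g')); [|exact: structure_mul|].
    rewrite (derivation_leibniz dY) //= (nbhs_singleton Ef) (nbhs_singleton Eg) psiK //.
    ring.
  by near=> z; rewrite /= (near Ef z) // (near Eg z).
Unshelve. all: by end_near. Qed.

(** Away from V the constant curves are integral curves.  At a point of V, where
    h o phi agrees with a function H of the structure, they are the images under
    phi of the curves of H Y. *)
Lemma cut_pushforward_vector_field : vector_field C (cut_pushforward h).
Proof.
apply: (vector_field_criterion sc cut_pushforward_derivation) => y.
have [Vy|nVy] := pselect (V y); last first.
  have : nbhs y [set z | h z = 0] by exact: h0.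
  rewrite nbhsE => -[Q oQ HQ]; exists Q, 1; split => // z Qz.
  exists (fun=> z); split => // t f _ Cf.
  by rewrite /cut_pushforward (HQ z Qz) mul0r; exact: is_derive_cst.
have Uy := psiU Vy.
have [H CH EH] := pullback_local (subspaceC (A := V) Ch) Uy.
have nW : nbhs (psi y) [set w | U w /\ H w = h (phi w)].
  have nU : \forall w \near psi y, U w by exact: open_nbhs_nbhs.
  by near=> w; split; near: w.
have [Q [e [nQ e0 HQ]]] := reparametrized_curves sc vY CH nW.
have nA : nbhs y [set z | V z /\ Q (psi z)].
  have nV : \forall z \near y, V z by exact: open_nbhs_nbhs.
  have nQ' : \forall z \near y, Q (psi z) by exact: (psi_continuous Vy).
  by near=> z; split; near: z.
move: nA; rewrite nbhsE => -[A oA HA]; exists A, e; split => // z Az.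
have [Vz Qz] := HA z Az; have [c oc Wc] := HQ (psi z) Qz; have [c0 D] := oc.
exists (phi \o c); split; first by rewrite /= c0 psiK.
move=> t f te Cf; have [Uc Hc] := Wc t te.
have [g Cg Eg] := pullback_local (subspaceC (A := V) Cf) Uc.
have cc := open_curve_continuous dsC oc te.
have -> : cut_pushforward h f ((phi \o c) t) = H (c t) * Y g (c t).
  rewrite /cut_pushforward /= -Hc; congr (_ * _).
  rewrite (pushforwardE (g := g)) ?phiK //.
apply: (near_eq_is_derive _ (D t g te Cg)).
exact: (cc _ Eg).
Unshelve. all: by end_near. Qed.

End CutOff.
End PushForward.

Theorem theorem2 (R : realType) (S : topologicalType) (C : set (S -> R))
    (hS : subcartesian C) :
  locally_complete C [set X | vector_field C X].
Proof.
move=> X Y _ vY t x U V phi psi [oU oV dphi _] Vx.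
have dsC := sc_structure hS.
have nV : nbhs x V by exact: open_nbhs_nbhs.
have [h bh] := bump_exists dsC nV; have [_ h1 _] := bh.
have vZ := cut_pushforward_vector_field hS vY oU oV dphi bh.
have : nbhs x [set y | V y /\ h y = 1] by apply: filterI.
rewrite nbhsE => -[W [oW Wx] HW].
exists W, (cut_pushforward (C := C) Y phi psi h); split => //; first by move=> y /HW [].
move=> f Cf y Wy; have [Vy hy] := HW y Wy.
have [g Cg fg] := subspace_structure_open oW Wy Cf.
have gf : \forall z \near y, g z = f z by apply: filterS fg => z ->.
rewrite (restrictionE dsC vZ.1 Cg gf) /cut_pushforward hy mul1r.
rewrite /restriction; set P := [set _ | _].
have [Ck kf] : P (xget (cst 0) P).
  apply: xgetPex; exists g; split => //.
  by apply: subspace_structure_near => z _; exists g => //; exact: nearW.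
apply: (pushforward_local hS vY oU dphi Vy Ck).
by near=> z; rewrite (near kf z) // (near fg z).
Unshelve. all: by end_near. Qed.
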